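(* Let $E$ be a finite set and let $\{Q_u:u\in[0,1]\}$ be a family of transition matrices on $E$ such that for each $u\in[0,1]$ the Markov chain with transition matrix $Q_u$ is irreducible and aperiodic. Let $\kappa\in(0,1)$ and assume that for all $(x,y)\in E^2$ the map $u\mapsto Q_u(x,y)$ is $\kappa$-Hölder continuous on $[0,1]$. Then: (i) each $Q_u$ has a single invariant probability $\pi_u$, the triangular array $\{X_{n,k}:n\ge1,k\le n\}$ is locally stationary, and there exists $C>0$, not depending on $u,n,k,j$, such that for all $u\in[0,1]$, $n\ge1$, $j\ge1$ and $k$ with $k+j-1\le n$, $$\|\pi^{(n)}_{k,j}-\pi_{u,j}\|_{TV}\le C\left[\sum_{s=k}^{k+j-1}\left|u-\frac sn\right|^\kappa+\frac1{n^\kappa}\right];$$ (ii) there exist $C'>0$, $\rho\in(0,1)$ and an integer $m\ge1$ such that $\beta_n(j)\le C'\rho^{[j/m]}$ for all integers $n\ge1$, $j\ge1$, where $[x]$ denotes the integer part of $x$.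
   Context: By convention $Q_u=Q_0$ for $u<0$ (so all objects attached to $Q_u$, $u<0$, are those attached to $Q_0$). For each integer $n\ge1$, $(X_{n,k})_{k\in\mathbb{Z},k\le n}$ is an $E$-valued non-homogeneous Markov chain with $\mathbb{P}(X_{n,k}=y\mid X_{n,k-1}=x)=Q_{k/n}(x,y)$ for $k\le n$; by convention $X_{n,k}$ is equal to a fixed constant for $k\ge n+1$. $\pi^{(n)}_{k,j}$ is the law of $(X_{n,k},\ldots,X_{n,k+j-1})$, and $\pi_{u,j}$ the law of $(X_1(u),\ldots,X_j(u))$ where $(X_k(u))_{k\in\mathbb{Z}}$ is a stationary Markov chain with transition matrix $Q_u$. $\|\mu-\nu\|_{TV}=\sup_A|\mu(A)-\nu(A)|$. The array is locally stationary if for every integer $j\ge1$ there exists a metric $\vartheta_j$ on the set $\mathcal{P}(E^j)$ of probability measures on $E^j$, metrizing the topology of weak convergence, such that (1) $u\mapsto\pi_{u,j}$ is continuous on $[0,1]$; (2) $\lim_{n\to\infty}\sup_{k\le n-j+1}\vartheta_j(\pi^{(n)}_{k,j},\pi_{k/n,j})=0$. With $\mathcal{F}^{(n)}_i=\sigma(X_{n,j}:j\le i)$, the $\beta$-mixing coefficient is $\beta_n(j)=\frac12\sup_{i\in\mathbb{Z}}\mathbb{E}\left[\sup_{\|f\|_\infty\le1}\left|\mathbb{E}[f(X_{n,i+j})\mid\mathcal{F}^{(n)}_i]-\mathbb{E}[f(X_{n,i+j})]\right|\right]$. *)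

(* Defs.v *)
From HB Require Import structures.
From mathcomp Require Export all_boot all_order all_algebra.
From mathcomp Require Export all_classical all_reals all_analysis.

Set Implicit Arguments.
Unset Strict Implicit.
Unset Printing Implicit Defensive.

Export Order.TTheory GRing.Theory Num.Theory.
Export numFieldNormedType.Exports.

Local Open Scope classical_set_scope.
Local Open Scope ring_scope.

(* A probability measure on a finite set is identified with its mass function. *)
Record pmf (R : realType) (T : finType) := Pmf {
  pmf_fun :> {ffun T -> R};
  _ : [forall x, 0 <= pmf_fun x] && (\sum_x pmf_fun x == 1) }.

HB.instance Definition _ (R : realType) (T : finType) :=
  [isSub for @pmf_fun R T].
HB.instance Definition _ (R : realType) (T : finType) :=
  [Choice of pmf R T by <:].

Definition prob_of (R : realType) (T : finType) (p : pmf R T) (A : {set T}) : R :=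
  \sum_(x in A) p x.

Definition tv_dist (R : realType) (T : finType) (p q : pmf R T) : R :=
  \big[Order.max/0]_(A : {set T}) `|prob_of p A - prob_of q A|.

Definition pmf_integral (R : realType) (T : finType) (p : pmf R T) :
    prod_topology (fun _ : T -> R => R) :=
  fun f => \sum_x f x * p x.

(* The topology of weak convergence: the coarsest one making p |-> \int f dp
   continuous for every f : T -> R; on the finite discrete space T, every
   function is bounded and continuous. *)
HB.instance Definition _ (R : realType) (T : finType) :=
  Topological.copy (pmf R T) (initial_topology (@pmf_integral R T)).

Definition is_metric (R : realType) (S : Type) (d : S -> S -> R) : Prop :=
  [/\ forall p q, 0 <= d p q,
      forall p q, d p q = 0 <-> p = q,
      forall p q, d p q = d q p &
      forall p q r, d p r <= d p q + d q r].

Definition metrizes (R : realType) (S : topologicalType) (d : S -> S -> R) : Prop :=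
  is_metric d /\
  forall (p : S) (U : set S),
    nbhs p U <-> exists2 e : R, 0 < e & [set q | d p q < e] `<=` U.

Definition is_transition (R : realType) (E : finType) (Q : E -> E -> R) : Prop :=
  (forall x y, 0 <= Q x y) /\ (forall x, \sum_y Q x y = 1).

Fixpoint nstep (R : realType) (E : finType) (Q : E -> E -> R) (n : nat)
    (x y : E) : R :=
  if n is m.+1 then \sum_z Q x z * nstep Q m z y else (x == y)%:R.

Definition irreducible (R : realType) (E : finType) (Q : E -> E -> R) : Prop :=
  forall x y, exists n : nat, 0 < nstep Q n x y.

(* The gcd of the set of possible return times is expressed through its common
   divisors, as this set is infinite. *)
Definition aperiodic (R : realType) (E : finType) (Q : E -> E -> R) : Prop :=
  forall (x : E) (d : nat),
    (forall n, (0 < n)%N -> 0 < nstep Q n x x -> (d %| n)%N) -> d = 1%N.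

Definition invariant_prob (R : realType) (E : finType) (Q : E -> E -> R)
    (p : pmf R E) : Prop :=
  forall y, \sum_x p x * Q x y = p y.

Definition holder_on_unit (R : realType) (kappa : R) (f : R -> R) : Prop :=
  exists2 L : R, 0 <= L & forall u v, u \in `[0, 1] -> v \in `[0, 1] ->
    `|f u - f v| <= L * `|u - v| `^ kappa.

Record process (R : realType) (E : finType) := Process {
  process_disp : measure_display;
  process_space : measurableType process_disp;
  process_prob : probability process_space R;
  process_val :> int -> process_space -> E;
  process_meas : forall k x, measurable (process_val k @^-1` [set x]) }.

Section Process.
Variables (R : realType) (E : finType) (X : process R E).

Definition pr (A : set (process_space X)) : R := fine (process_prob X A).

Definition cond_pr (A B : set (process_space X)) : R := pr (A `&` B) / pr B.

Definition window (k : int) (j : nat) (w : process_space X) : j.-tuple E :=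
  [tuple X (k + (i : nat)%:Z) w | i < j].

Lemma measurable_window k j (x : j.-tuple E) :
  measurable (window k j @^-1` [set x]).
Proof.
have -> : window k j @^-1` [set x] =
    \bigcap_(i in [set: 'I_j]) (X (k + (i : nat)%:Z) @^-1` [set tnth x i]).
  apply/seteqP; split=> w /=.
    by move=> <- i _ /=; rewrite tnth_mktuple.
  by move=> h; apply: eq_from_tnth => i; rewrite tnth_mktuple; exact: h.
by apply: fin_bigcap_measurable => // i _; exact: process_meas.
Qed.

Lemma law_subproof k j :
  let f := [ffun x : j.-tuple E => pr (window k j @^-1` [set x])] in
  [forall x, 0 <= f x] && (\sum_x f x == 1).
Proof.
apply/andP; split.
  by apply/forallP => x; rewrite ffunE fine_ge0.
apply/eqP; apply: EFin_inj; rewrite -sumEFin.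
under eq_bigr => x _.
  rewrite ffunE fineK; last by apply: fin_num_measure; exact: measurable_window.
  over.
rewrite (fsbig_seq _ _ (index_enum_uniq _)) -measure_fin_bigcup.
- rewrite -(@probability_setT _ _ _ (process_prob X)); congr (_ _).
  apply/seteqP; split=> // w _.
  by exists (window k j w) => //=; rewrite mem_index_enum.
- exact: finite_seq.
- by move=> x y _ _ [w [/= <- <-]].
- by move=> x _; exact: measurable_window.
Qed.

(* The law of (X_k, ..., X_(k+j-1)). *)
Definition law (k : int) (j : nat) : pmf R (j.-tuple E) := Pmf (law_subproof k j).

(* For each time k in D, the transition from k-1 to k is given by q k;
   conditional probabilities are only constrained when the conditioning event
   has positive probability. *)
Definition markov_chain (D : set int) (q : int -> E -> E -> R) : Prop :=
  forall k, D k ->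
    (forall (m : nat) (x : nat -> E) (y : E),
       let past := [set w | forall i : nat, (i <= m)%N -> X (k - 1 - i%:Z) w = x i] in
       0 < pr past ->
       cond_pr (X k @^-1` [set y]) past =
       cond_pr (X k @^-1` [set y]) (X (k - 1) @^-1` [set x 0%N])) /\
    (forall x y : E,
       0 < pr (X (k - 1) @^-1` [set x]) ->
       cond_pr (X k @^-1` [set y]) (X (k - 1) @^-1` [set x]) = q k x y).

Definition stationary : Prop := forall (k l : int) (j : nat), law k j = law l j.

Definition stationary_markov_chain (Q : E -> E -> R) : Prop :=
  markov_chain [set: int] (fun=> Q) /\ stationary.

End Process.

Section CondExp.
Variables (R : realType) (d : measure_display) (T : measurableType d).
Variable P : probability T R.

(* g is a version of the conditional expectation of f given sigma(G). *)
Definition is_cond_exp (G : set (set T)) (f g : T -> R) : Prop :=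
  [/\ measurable_fun [set: g_sigma_algebraType G] (g : g_sigma_algebraType G -> R),
      P.-integrable [set: T] (EFin \o g) &
      forall A, <<s G >> A ->
        (\int[P]_(w in A) (g w)%:E = \int[P]_(w in A) (f w)%:E)%E].

Definition cond_exp (G : set (set T)) (f : T -> R) : T -> R :=
  xget (cst 0) [set g | is_cond_exp G f g].

End CondExp.

Section Mixing.
Variables (R : realType) (E : finType) (X : process R E).

(* Generators of the sigma-algebra F_i of the past up to time i. *)
Definition past_gen (i : int) : set (set (process_space X)) :=
  [set A | exists l : int, exists B : set E, l <= i /\ A = X l @^-1` B].

(* E[f(X_l) | F_i], computed from one regular version of the conditional law of
   X_l given F_i. Conditional expectations are only defined almost surely, so
   the uncountable supremum over f in [beta] requires versions that are chosen
   consistently in f. *)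
Definition cond_exp_past (i l : int) (f : E -> R) (w : process_space X) : R :=
  \sum_y f y * cond_exp (process_prob X) (past_gen i) (\1_(X l @^-1` [set y])) w.

Definition beta (j : nat) : \bar R :=
  ((2^-1)%:E * ereal_sup [set
     \int[process_prob X]_w
       ereal_sup [set (`| cond_exp_past i (i + j%:Z) f w
                         - fine 'E_(process_prob X)[f \o X (i + j%:Z)] |)%:E
                 | f in [set f : E -> R | forall y, (`|f y| <= 1)%R]]
   | i in [set: int]])%E.

End Mixing.

(* The convention Q_u = Q_0 for u < 0. *)
Definition clip (R : realType) (u : R) : R := Num.max 0 u.

Definition locally_stationary (R : realType) (E : finType)
    (X : nat -> process R E) (pi_ : R -> forall j : nat, pmf R (j.-tuple E)) : Prop :=
  forall j : nat, (0 < j)%N ->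
  exists vartheta : pmf R (j.-tuple E) -> pmf R (j.-tuple E) -> R,
    [/\ metrizes vartheta,
        {within `[0, 1], continuous (fun u : R => pi_ u j)} &
        (fun n : nat => ereal_sup
           [set (vartheta (law (X n) k j) (pi_ (clip (k%:~R / n%:R)) j))%:E
           | k in [set k : int | k <= n%:Z - j%:Z + 1]]) @ \oo --> 0%E].

(* Main.v *)
(* Doeblin's condition makes a fixed number of steps of a primitive Q_u a strict
   contraction, in l^1, of the signed vectors of total mass 0.  Since Q_u is
   continuous in u, this contraction survives when the steps use slightly
   different parameters, and compactness of [0, 1] makes block length, tolerance
   and rate uniform.  Hence there are M and r < 1 such that any M consecutive
   steps of any row of the array contract by r.  This yields geometric
   beta-mixing at once, and, comparing a block of the array with M steps of Q_u,
   an inequality d_k <= r d_(k-M) + (Hölder error) for the distance d_k between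
   the law of X_{n,k} and pi_u.  The laws of windows are then compared one
   transition at a time. *)
Require Import Defs.
From mathcomp Require Import ring lra zify measurable_realfun.

Set Implicit Arguments.
Unset Strict Implicit.
Unset Printing Implicit Defensive.

Local Open Scope classical_set_scope.
Local Open Scope ring_scope.

(** * Evolution of signed vectors under transition matrices *)

Section Kernels.
Variables (R : realType) (E : finType).
Implicit Types (v w : E -> R) (K Q : E -> E -> R) (k : nat -> E -> E -> R).

(** Differences of two probability vectors have mass 0 and evolve linearly, so one contraction
    inequality yields the uniqueness of pi_u, its Hölder dependence on u, the distance of the
    marginals to pi_u and the loss of memory in beta. A row has no initial law, so the recursion for
    d_k has no first value: the crude bound d <= 2, taken m blocks back, replaces it and is killed
    by r^m. Going back moves the parameter away from k/n, but t^kappa is subadditive, so each block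
    adds only a multiple of 1/n^kappa; this is the origin of that term. On the finite space E^j the
    l^1 distance of mass functions metrizes weak convergence and dominates total variation, so one
    estimate serves both local stationarity and the explicit bound. *)

Definition l1norm (T : finType) (v : T -> R) : R := \sum_x `|v x|.

Definition push v K : E -> R := fun y => \sum_x v x * K x y.

Fixpoint evolve v k (n : nat) : E -> R :=
  if n is m.+1 then push (evolve v k m) (k m) else v.

(** Transition matrices preserve mass, so a rate below 1 can only hold on vectors of mass 0; the
    operator norm there is Dobrushin's ergodicity coefficient of the product of kernels. *)
Definition contracting k (n : nat) (r : R) : Prop :=
  forall v, \sum_x v x = 0 -> l1norm (evolve v k n) <= r * l1norm v.

Lemma l1norm_ge0 (T : finType) (v : T -> R) : 0 <= l1norm v.
Proof. by apply: sumr_ge0. Qed.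

Lemma l1norm_triangle (T : finType) (u v w : T -> R) :
  l1norm (u \- w) <= l1norm (u \- v) + l1norm (v \- w).
Proof.
rewrite /l1norm -big_split; apply: ler_sum => x _ /=.
by rewrite (_ : u x - w x = (u x - v x) + (v x - w x)) ?ler_normD//; ring.
Qed.

Lemma l1norm_sub_le (T : finType) (v w : T -> R) :
  l1norm (v \- w) <= l1norm v + l1norm w.
Proof.
by rewrite /l1norm -big_split; apply: ler_sum => x _ /=; rewrite ler_normB.
Qed.

Lemma l1norm_prob (T : finType) (v : T -> R) :
  (forall x, 0 <= v x) -> \sum_x v x = 1 -> l1norm v = 1.
Proof. by move=> v0 <-; apply: eq_bigr => x _; rewrite ger0_norm. Qed.

Lemma pushB v w K : push (v \- w) K = push v K \- push w K.
Proof.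
apply/funext => y /=; rewrite /push -sumrB.
by apply: eq_bigr => x _; rewrite /= mulrBl.
Qed.

Lemma push_sum v K : is_transition K -> \sum_y push v K y = \sum_x v x.
Proof.
move=> [_ K1]; rewrite exchange_big /=.
by apply: eq_bigr => x _; rewrite -mulr_sumr K1 mulr1.
Qed.

Lemma l1norm_push_le v K (a : R) :
  (forall x, \sum_y `|K x y| <= a) -> l1norm (push v K) <= a * l1norm v.
Proof.
move=> Ka; apply: (@le_trans _ _ (\sum_y \sum_x `|v x| * `|K x y|)).
  apply: ler_sum => y _; apply: le_trans (ler_norm_sum _ _ _) _.
  by apply: ler_sum => x _; rewrite normrM.
rewrite exchange_big /= mulr_sumr; apply: ler_sum => x _.
by rewrite -mulr_sumr mulrC ler_wpM2r.
Qed.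

Lemma l1norm_push v K : is_transition K -> l1norm (push v K) <= l1norm v.
Proof.
move=> [K0 K1]; rewrite -[leRHS]mul1r; apply: l1norm_push_le => x.
by rewrite -(K1 x); apply: ler_sum => y _; rewrite ger0_norm.
Qed.

Lemma l1norm_push_dist v K K' (a : R) :
  (forall x, \sum_y `|K x y - K' x y| <= a) ->
  l1norm (push v K \- push v K') <= a * l1norm v.
Proof.
move=> Ka; rewrite (_ : _ \- _ = push v (fun x y => K x y - K' x y)).
  exact: l1norm_push_le.
apply/funext => y /=; rewrite /push -sumrB.
by apply: eq_bigr => x _; rewrite mulrBr.
Qed.

Lemma evolveB v w k n : evolve (v \- w) k n = evolve v k n \- evolve w k n.
Proof. by elim: n => //= n ->; rewrite pushB. Qed.

Lemma evolveD v k m n :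
  evolve v k (m + n) = evolve (evolve v k m) (fun i => k (m + i)%N) n.
Proof. by elim: n => [|n IH]; rewrite ?addn0// addnS /= IH. Qed.

Lemma evolveSl v k n : evolve v k n.+1 = evolve (push v (k 0%N)) (k \o S) n.
Proof. by rewrite -addn1 addnC evolveD. Qed.

Lemma eq_evolve v k k' n :
  (forall i, (i < n)%N -> k i = k' i) -> evolve v k n = evolve v k' n.
Proof.
by elim: n => //= n IH kk'; rewrite IH ?kk'// => i /ltnW ?; exact: kk'.
Qed.

Lemma evolve_sum v k n : (forall i, (i < n)%N -> is_transition (k i)) ->
  \sum_x evolve v k n x = \sum_x v x.
Proof.
elim: n => //= n IH hk; rewrite push_sum ?IH//; last exact: hk.
by move=> i /ltnW; exact: hk.
Qed.

Lemma l1norm_evolve v k n : (forall i, (i < n)%N -> is_transition (k i)) ->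
  l1norm (evolve v k n) <= l1norm v.
Proof.
elim: n => //= n IH hk; apply: le_trans (l1norm_push _ (hk _ _)) _ => //.
by apply: IH => i /ltnW; exact: hk.
Qed.

(** The kernels are exchanged one at a time: each exchange costs at most [a] times the norm of [v],
    and the other factors do not increase l^1 norms. *)
Lemma evolve_dist v k k' n (a : R) :
  (forall i, (i < n)%N -> is_transition (k i)) ->
  (forall i, (i < n)%N -> is_transition (k' i)) ->
  (forall i x, (i < n)%N -> \sum_y `|k i x y - k' i x y| <= a) -> 0 <= a ->
  l1norm (evolve v k n \- evolve v k' n) <= n%:R * a * l1norm v.
Proof.
move=> + + + a0; elim: n => [_ _ _|n IH hk hk' ha] /=.
  by rewrite /l1norm big1 ?mul0r// => x _; rewrite /= subrr normr0.
apply: le_trans (l1norm_triangle _ (push (evolve v k' n) (k n)) _) _.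
rewrite -pushB -natr1 !mulrDl mul1r lerD//.
  apply: le_trans (l1norm_push _ (hk _ _)) _ => //.
  by apply: IH => i *; [apply: hk|apply: hk'|apply: ha]; exact: ltnW.
apply: le_trans (l1norm_push_dist (a := a) _ _) _; first by move=> x; apply: ha.
by rewrite ler_wpM2l// l1norm_evolve// => i /ltnW; exact: hk'.
Qed.

Lemma eq_contracting k k' n r :
  (forall i, (i < n)%N -> k i = k' i) ->
  contracting k n r -> contracting k' n r.
Proof. by move=> kk' h v v0; rewrite -(eq_evolve _ kk'); exact: h. Qed.

Lemma contracting_add k m n r :
  (forall i, (i < n)%N -> is_transition (k (m + i)%N)) ->
  contracting k m r -> contracting k (m + n) r.
Proof.
move=> hk h v v0; rewrite evolveD.
by apply: le_trans (h v v0); rewrite l1norm_evolve.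
Qed.

Lemma contracting_iter k m r j : 0 <= r ->
  (forall i, is_transition (k i)) ->
  (forall l, contracting (fun i => k (l + i)%N) m r) ->
  contracting k j (r ^+ (j %/ m)).
Proof.
move=> r0 hk h.
have blocks q : contracting k (q * m) (r ^+ q).
  elim: q => [v _|q IH v v0]; first by rewrite mul0n expr0 mul1r.
  rewrite mulSn addnC evolveD; apply: le_trans (h _ _ _) _.
    by rewrite evolve_sum.
  by rewrite exprS -mulrA ler_wpM2l// IH.
(* The last [j %% m] steps merely do not expand; hence the integer part in the exponent. *)
by rewrite {1}(divn_eq j m); apply: contracting_add.
Qed.

Lemma evolve_nstep v Q n y :
  evolve v (fun=> Q) n y = \sum_x v x * nstep Q n x y.
Proof.
elim: n v => [v|n IH v] /=.
  rewrite (bigD1 y)//= eqxx mulr1 big1 ?addr0// => x /negPf ->.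
  by rewrite mulr0.
rewrite -/(evolve v (fun=> Q) n.+1) evolveSl IH.
transitivity (\sum_z \sum_x v x * Q x z * nstep Q n z y).
  by apply: eq_bigr => z _; rewrite /push mulr_suml.
rewrite exchange_big; apply: eq_bigr => x _ /=; rewrite mulr_sumr.
by apply: eq_bigr => z _; rewrite mulrA.
Qed.

Lemma evolve_delta v p n y :
  evolve v p n y = \sum_x v x * evolve (fun z => (x == z)%:R) p n y.
Proof.
elim: n y => [|n IH] y /=.
  rewrite (bigD1 y)//= eqxx mulr1 big1 ?addr0// => x /negPf ->.
  by rewrite mulr0.
transitivity (\sum_z \sum_x
    v x * evolve (fun z' => (x == z')%:R) p n z * p n z y).
  by apply: eq_bigr => z _; rewrite IH mulr_suml.
rewrite exchange_big; apply: eq_bigr => x _ /=; rewrite mulr_sumr.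
by apply: eq_bigr => z _; rewrite mulrA.
Qed.

Lemma nstep_transition Q n : is_transition Q -> is_transition (nstep Q n).
Proof.
move=> [Q0 Q1]; elim: n => [|n [h0 h1]]; split=> //=.
- move=> x; rewrite (bigD1 x)//= eqxx big1 ?addr0// => y.
  by rewrite eq_sym => /negPf ->.
- by move=> x y; apply: sumr_ge0 => z _; rewrite mulr_ge0.
- move=> x; rewrite exchange_big -(Q1 x) /=; apply: eq_bigr => z _.
  by rewrite -mulr_sumr h1 mulr1.
Qed.

Lemma nstep_mul_le Q m n x y z : is_transition Q ->
  nstep Q m x y * nstep Q n y z <= nstep Q (m + n) x z.
Proof.
move=> hQ; elim: m x => [|m IH] x /=.
  rewrite add0n; case: eqVneq => [->|_]; first by rewrite mul1r.
  by rewrite mul0r (nstep_transition n hQ).1.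
rewrite mulr_suml; apply: ler_sum => w _.
by rewrite -mulrA ler_wpM2l// hQ.1.
Qed.

Lemma nstep_gt0_add Q m n x y z : is_transition Q ->
  0 < nstep Q m x y -> 0 < nstep Q n y z -> 0 < nstep Q (m + n) x z.
Proof.
move=> hQ mxy nyz; apply: lt_le_trans (nstep_mul_le m n x y z hQ).
exact: mulr_gt0.
Qed.

(** On vectors of mass 0, lowering all entries of Q^n by [e] changes nothing; the matrix stays
    nonnegative and its row sums become 1 - e [#|E|], which is at most 1 - e. *)
Lemma contracting_doeblin Q n (e : R) : is_transition Q -> 0 <= e ->
  (forall x y, e <= nstep Q n x y) -> contracting (fun=> Q) n (1 - e).
Proof.
move=> hQ e0 eQ v v0; have [Q0 Q1] := nstep_transition n hQ.
rewrite (_ : evolve _ _ _ = push v (fun x y => nstep Q n x y - e)); last first.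
  apply/funext => y; rewrite evolve_nstep /push.
  under [RHS]eq_bigr do rewrite mulrBr.
  by rewrite sumrB -mulr_suml v0 mul0r subr0.
apply: l1norm_push_le => x.
under eq_bigr => y _ do rewrite ger0_norm ?subr_ge0//.
rewrite sumrB Q1 lerD2l lerN2 (bigD1 x)//= lerDl.
exact: sumr_ge0.
Qed.

End Kernels.

(* The least gap between two elements of S divides every element, hence is 1;
   and b, b + 1 generate every integer from b ^ 2 on. *)
Lemma semigroup_eventually (S : nat -> Prop) :
  (forall a b, S a -> S b -> S (a + b)%N) ->
  (forall d, (forall n, (0 < n)%N -> S n -> (d %| n)%N) -> d = 1%N) ->
  exists N, forall n, (N <= n)%N -> S n.
Proof.
move=> Sadd Sgcd.
have [a a_gt0 Sa] : exists2 a, (0 < a)%N & S a.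
  (* If S had no positive element, every d, even 0, would be a common divisor. *)
  apply: contrapT => h; suff: 0%N = 1%N by [].
  by apply: Sgcd => n n0 Sn; exfalso; apply: h; exists n.
have Smul q x : (0 < q)%N -> S x -> S (q * x)%N.
  move=> + Sx; elim: q => // -[|q] IH _; first by rewrite mul1n.
  by rewrite mulSn; apply: Sadd => //; exact: IH.
pose gap d := `[< (0 < d)%N /\ exists2 b, S b & S (b + d)%N >].
have gapa : exists d, gap d.
  by exists a; apply/asboolP; split=> //; exists a => //; exact: Sadd.
case: (ex_minnP gapa) => d /asboolP[d0 [b Sb Sbd]] dmin.
have b0 : (0 < b \/ b = 0)%N by case: b {Sb Sbd} => [|b]; [right|left].
have d1 : d = 1%N.
  apply: Sgcd => n n0 Sn; rewrite /dvdn; apply: contraT => r0.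
  have := divn_eq n d; set q := (n %/ d)%N; set r := (n %% d)%N => nE.
  suff /dmin : gap r by rewrite leqNgt ltn_mod d0.
  apply/asboolP; split; first by rewrite lt0n.
  case: (posnP q) => [q0|q_gt0].
    exists n => //; rewrite q0 mul0n add0n in nE.
    by rewrite -nE; exact: Sadd.
  (* Both q (b + d) and q b + n lie in S, and they differ by r, which is below the least gap. *)
  exists (q * (b + d))%N; first exact: Smul.
  rewrite (_ : _ + r = q * b + n)%N; last by rewrite nE; lia.
  by apply: Sadd => //; exact: Smul.
rewrite d1 addn1 in Sbd; exists (b * b + 1)%N => n hn.
case: b0 => [b0|b0]; last first.
  by rewrite -(muln1 n); apply: Smul; [lia | rewrite b0 in Sbd].
have := divn_eq n b; have := ltn_pmod n b0.
set q := (n %/ b)%N; set r := (n %% b)%N => rb nE.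
have bq : (b <= q)%N by rewrite /q leq_divRL//; lia.
rewrite (_ : n = (q - r) * b + r * b.+1)%N; last by nia.
case: (posnP r) => [->|r0].
  by rewrite mul0n addn0; apply: Smul => //; lia.
by apply: Sadd; apply: Smul => //; lia.
Qed.

(** * Primitivity and invariant probabilities of a single transition matrix *)

Section Ergodic.
Variables (R : realType) (E : finType) (Q : E -> E -> R).
Hypothesis hQ : is_transition Q.

(** The return times to x form a semigroup without common divisor, so they include all large
    integers; a path from x to y shifts the threshold, and the finitely many pairs share one. *)
Lemma primitive : irreducible Q -> aperiodic Q ->
  exists n, forall x y, 0 < nstep Q n x y.
Proof.
move=> hirr haper.
suff [n _ h] : \forall n \near \oo, forall x y, 0 < nstep Q n x y.
  by exists n; exact: (h n (leqnn n)).
apply: filter_forall => x; apply: filter_forall => y.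
have [N hN] : exists N, forall n, (N <= n)%N -> 0 < nstep Q n x x.
  apply: semigroup_eventually; last exact: haper.
  by move=> a b; exact: nstep_gt0_add.
have [p hp] := hirr x y.
exists (N + p)%N => // n /= hn; rewrite -(subnK (n := n) (m := p)); last lia.
by apply: nstep_gt0_add hp => //; apply: hN; lia.
Qed.

(* If v Q = v then |v| <= |v| Q entrywise, and both sides have the same total
   mass, so |v| is invariant as well. *)
Lemma exists_invariant (c : E) : exists p : pmf R E, invariant_prob Q p.
Proof.
pose n := #|E|.
pose A : 'M[R]_n :=
  \matrix_(i, j) (Q (enum_val i) (enum_val j) - (i == j)%:R).
have sumE (f : E -> R) : \sum_x f x = \sum_(i < n) f (enum_val i).
  by rewrite (reindex (@enum_val E E))//; exact: onW_bij (@enum_val_bij _).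
(* The rows of Q - I sum to 0, so the constant vector, nonzero because E contains [c], is a right
   null vector; the vanishing determinant then supplies a left one, of unknown signs. *)
have : \det A == 0.
  rewrite -det_tr; apply/det0P; exists (const_mx 1).
    apply/eqP => /rowP/(_ (enum_rank c)); rewrite !mxE => /eqP.
    by rewrite oner_eq0.
  apply/rowP => i; rewrite !mxE.
  under eq_bigr do rewrite !mxE mul1r.
  rewrite sumrB -sumE hQ.2 (bigD1 i)//= eqxx big1 ?addr0 ?subrr// => j.
  by rewrite eq_sym => /negPf ->.
case/det0P => v v0 vA; pose w x := `|v 0 (enum_rank x)|.
have vE y : v 0 (enum_rank y) = \sum_x v 0 (enum_rank x) * Q x y.
  move/rowP/(_ (enum_rank y)) : vA; rewrite !mxE.
  have -> : \sum_(i < n) v 0 i * (A i (enum_rank y)) =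
      \sum_(i < n) v 0 i * Q (enum_val i) y - v 0 (enum_rank y).
    transitivity (\sum_(i < n) (v 0 i * Q (enum_val i) y
                                 - v 0 i * (i == enum_rank y)%:R)).
      by apply: eq_bigr => i _; rewrite mxE enum_rankK mulrBr.
    rewrite sumrB; congr (_ - _); rewrite (bigD1 (enum_rank y))//= eqxx mulr1.
    by rewrite big1 ?addr0// => i /negPf ->; rewrite mulr0.
  move/subr0_eq => <-; rewrite sumE.
  by apply: eq_bigr => i _; rewrite enum_valK.
have wle y : w y <= push w Q y.
  rewrite /w vE; apply: le_trans (ler_norm_sum _ _ _) _.
  by apply: ler_sum => x _; rewrite normrM (ger0_norm (hQ.1 _ _)).
have wE y : push w Q y = w y.
  apply/eqP; rewrite -subr_eq0; move: y (erefl true).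
  have /eqP : \sum_y (push w Q y - w y) = 0.
    by rewrite sumrB push_sum// subrr.
  rewrite psumr_eq0 => [/allP h y _|y _]; last by rewrite subr_ge0.
  exact: h (mem_index_enum y).
have s0 : 0 < \sum_x w x.
  rewrite lt_def; apply/andP; split; last first.
    by apply: sumr_ge0 => x _; exact: normr_ge0.
  rewrite psumr_neq0; last by move=> x _; exact: normr_ge0.
  have [i vi] : exists i, v 0 i != 0.
    by apply/existsP; rewrite -negb_forall; apply: contra v0 => /forallP h;
      apply/eqP/rowP => i; rewrite mxE; exact/eqP.
  apply/hasP; exists (enum_val i); rewrite ?mem_index_enum//= /w enum_valK.
  by rewrite normr_gt0.
pose f := [ffun x => w x / \sum_x w x].
have fP : [forall x, 0 <= f x] && (\sum_x f x == 1).
  apply/andP; split.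
    apply/forallP => x; rewrite ffunE.
    by apply: divr_ge0; [exact: normr_ge0|exact: ltW].
  under eq_bigr do rewrite ffunE.
  by rewrite -mulr_suml divff// gt_eqF.
exists (Pmf fP) => y; rewrite /= ffunE -wE /push mulr_suml.
by apply: eq_bigr => x _; rewrite ffunE mulrAC.
Qed.

Lemma evolve_invariant (p : E -> R) n :
  push p Q = p -> evolve p (fun=> Q) n = p.
Proof. by move=> pQ; elim: n => //= n ->. Qed.

Lemma l1norm_eq0 (v : E -> R) : l1norm v <= 0 -> forall x, v x = 0.
Proof.
move=> v0 x; apply/normr0_eq0/le_anti; rewrite normr_ge0 andbT.
apply: le_trans v0; rewrite /l1norm (bigD1 x)//= lerDl.
exact: sumr_ge0.
Qed.

Lemma contracting_unique n r (p q : E -> R) :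
  contracting (fun=> Q) n r -> r < 1 ->
  \sum_x p x = \sum_x q x -> push p Q = p -> push q Q = q -> p = q.
Proof.
move=> hc r1 pq pE qE; apply/funext => x; apply/eqP; rewrite -subr_eq0.
apply/eqP; move: x; apply: (@l1norm_eq0 (p \- q)).
have := hc (p \- q); rewrite evolveB !evolve_invariant// sumrB pq subrr.
move=> /(_ erefl) h; have : (1 - r) * l1norm (p \- q) <= 0 by lra.
by rewrite pmulr_rle0// subr_gt0.
Qed.

End Ergodic.

(** * Uniform contraction *)

(** A ratio t in (0, 1] satisfies t <= t^p when p <= 1; this is applied to the shares of a and b in
    a + b, which sum to 1. *)
Lemma powR_subadditive (R : realType) (p a b : R) :
  0 < p <= 1 -> 0 <= a -> 0 <= b -> (a + b) `^ p <= a `^ p + b `^ p.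
Proof.
move=> /andP[p0 p1] a0 b0.
have [ab0|ab0] := eqVneq (a + b) 0.
  by rewrite ab0 powR0 ?gt_eqF// addr_ge0// powR_ge0.
have ab : 0 < a + b by rewrite lt_def ab0 addr_ge0.
have frac c : 0 <= c -> c <= a + b -> c / (a + b) * (a + b) `^ p <= c `^ p.
  rewrite le_eqVlt => /predU1P[<- _|c0 cab]; first by rewrite !mul0r powR_ge0.
  have q0 : 0 < c / (a + b) by rewrite divr_gt0.
  have cE : c = c / (a + b) * (a + b) by rewrite divfK// gt_eqF.
  rewrite [X in _ <= X `^ _]cE (powRM _ (ltW q0) (ltW ab)).
  rewrite ler_wpM2r ?powR_ge0// -[leLHS](powRr1 (ltW q0)).
  by apply: ger_powR => //; rewrite q0 ler_pdivrMr// mul1r.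
have := lerD (frac a a0 _) (frac b b0 _); rewrite -mulrDl -mulrDl divff// mul1r.
by apply; rewrite ?lerDl ?lerDr.
Qed.

Lemma powRV (R : realType) (x p : R) : 0 < x -> (x^-1) `^ p = (x `^ p)^-1.
Proof.
move=> x0; have xp0 : 0 < x `^ p by rewrite powR_gt0.
apply: (mulfI (lt0r_neq0 xp0)); rewrite -powRM ?invr_ge0 ?ltW//.
by rewrite !divff ?gt_eqF// powR1.
Qed.

Lemma clip_itv (R : realType) (u : R) : u <= 1 -> clip u \in `[0, 1].
Proof. by move=> u1; rewrite in_itv/= /clip le_max lexx ge_max ler01 u1. Qed.

Lemma clip_id (R : realType) (u : R) : u \in `[0, 1] -> clip u = u.
Proof. by rewrite in_itv/= /clip => /andP[u0 _]; rewrite max_r. Qed.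

Lemma clip_dist (R : realType) (u v : R) : `|clip u - clip v| <= `|u - v|.
Proof.
rewrite /clip !maxEle; case: (leP 0 u) => u0; case: (leP 0 v) => v0 //.
- by rewrite subr0 !ger0_norm //; lra.
- by rewrite sub0r normrN [leRHS]distrC !ger0_norm //; lra.
- by rewrite subrr normr0.
Qed.

Lemma mem_unit_clip_ratio (R : realType) (n : nat) (k : int) :
  (0 < n)%N -> k <= n%:Z -> clip (k%:~R / n%:R) \in `[0 : R, 1].
Proof.
move=> n0 kn; apply: clip_itv; rewrite ler_pdivrMr ?ltr0n// mul1r.
by rewrite -[n%:R]/(n%:Z%:~R) ler_int.
Qed.

Section Family.
Variables (R : realType) (E : finType) (Q : R -> E -> E -> R) (kappa : R).
Hypothesis hQ : forall u : R, u \in `[0, 1] -> is_transition (Q u).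
Hypothesis hkappa : 0 < kappa < 1.
Hypothesis hholder : forall x y, holder_on_unit kappa (fun u => Q u x y).

Lemma holder_rows : exists2 G : R, 0 < G &
  forall x u v, u \in `[0, 1] -> v \in `[0, 1] ->
    \sum_y `|Q u x y - Q v x y| <= G * `|u - v| `^ kappa.
Proof.
have /choice[L hL] (p : E * E) : exists L : R, 0 <= L /\
    forall u v, u \in `[0, 1] -> v \in `[0, 1] ->
      `|Q u p.1 p.2 - Q v p.1 p.2| <= L * `|u - v| `^ kappa.
  by have [L L0 h] := hholder p.1 p.2; exists L.
pose S := \sum_x \sum_y L (x, y).
have S0 : 0 <= S by do 2!apply: sumr_ge0 => ? _; exact: (hL _).1.
(* The added 1 makes the constant positive, so that it can be divided by. *)
exists (S + 1); first by rewrite ltr_wpDl.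
move=> x u v hu hv; apply: (@le_trans _ _ (S * `|u - v| `^ kappa)); last first.
  by rewrite ler_wpM2r ?powR_ge0// lerDl.
apply: (@le_trans _ _ ((\sum_y L (x, y)) * `|u - v| `^ kappa)).
  by rewrite mulr_suml; apply: ler_sum => y _; exact: (hL (x, y)).2.
rewrite ler_wpM2r ?powR_ge0// /S [leRHS](bigD1 x)//= lerDl.
by do 2!apply: sumr_ge0 => ? _; exact: (hL _).1.
Qed.

Hypothesis hirr : forall u : R, u \in `[0, 1] -> irreducible (Q u).
Hypothesis haper : forall u : R, u \in `[0, 1] -> aperiodic (Q u).

Lemma local_contraction (u0 : R) : u0 \in `[0, 1] ->
  exists (m : nat) (d r : R), [/\ 0 < d, r < 1 &
    forall w : nat -> R,
      (forall i, (i < m)%N -> w i \in `[0, 1] /\ `|w i - u0| < d) ->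
      contracting (Q \o w) m r].
Proof.
move=> hu0; have [m mpos] := primitive (hQ hu0) (hirr hu0) (haper hu0).
have [e e01 he] : exists2 e : R, 0 < e <= 1 &
    forall x y, e <= nstep (Q u0) m x y.
  pose e := \big[Order.min/1]_(p : E * E) nstep (Q u0) m p.1 p.2.
  exists e.
    apply/andP; split; last exact: bigmin_le_id.
    by apply: lt_bigmin => // p _; exact: mpos.
  by move=> x y; exact: (bigmin_inf (x, y)).
have /andP[e0 e1] := e01.
have [G G0 hG] := holder_rows.
have /andP[k0 _] := hkappa.
(* Perturbing m steps costs at most m a <= e / 2, half of the Doeblin gain; [m.+1] covers m = 0. The
   radius [d] solves G d^kappa = a. *)
pose a := e / (2 * m.+1%:R); pose d := (a / G) `^ kappa^-1.
have a0 : 0 < a by rewrite divr_gt0// mulr_gt0.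
have d0 : 0 < d by rewrite powR_gt0// divr_gt0.
exists m, d, (1 - e / 2); split=> //; first by lra.
move=> w hw v v0.
have tr i : (i < m)%N -> is_transition ((Q \o w) i).
  by move=> /hw[wi _]; exact: hQ.
have dist i x : (i < m)%N -> \sum_y `|(Q \o w) i x y - Q u0 x y| <= a.
  move=> /hw[wi /ltW wid]; apply: le_trans (hG x _ _ wi hu0) _.
  rewrite mulrC -ler_pdivlMr//.
  rewrite [leRHS](_ : _ = d `^ kappa); last first.
    by rewrite /d -powRrM mulVf ?gt_eqF// powRr1// ltW// divr_gt0.
  by apply: ge0_ler_powR => //; rewrite ?ltW// nnegrE// ltW.
have h := contracting_doeblin (hQ hu0) (ltW e0) he v0.
have h' := evolve_dist v tr (fun i _ => hQ hu0) dist (ltW a0).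
have tri : l1norm (evolve v (Q \o w) m) <=
    l1norm (evolve v (Q \o w) m \- evolve v (fun=> Q u0) m)
    + l1norm (evolve v (fun=> Q u0) m).
  rewrite /l1norm -big_split; apply: ler_sum => x _ /=.
  by rewrite -[X in `|X| <= _](subrK (evolve v (fun=> Q u0) m x)) ler_normD.
apply: (le_trans tri); apply: le_trans (lerD h' h) _.
rewrite -mulrDl ler_wpM2r ?l1norm_ge0//.
suff : m%:R * a <= e / 2 by lra.
rewrite (_ : e / 2 = m.+1%:R * a); last by rewrite /a; field.
by rewrite ler_wpM2r ?ler_nat// ltW.
Qed.

(** A single integer N encodes the block length N, the tolerance 1/(N+2) and the rate 1 - 1/(N+2). A
    local contraction at u0 then implies [P N u] for all large N and all u near u0, which is the
    form in which compactness is applied; the 2 keeps the rate inside (0, 1). *)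
Lemma uniform_contraction : exists (N : nat) (d r : R),
  [/\ 0 < d, 0 < r < 1 &
    forall (u : R) (w : nat -> R), u \in `[0, 1] ->
      (forall i, (i < N)%N -> w i \in `[0, 1] /\ `|w i - u| <= d) ->
      contracting (Q \o w) N r].
Proof.
pose P (N : nat) (u : R) := forall w : nat -> R,
  (forall i, (i < N)%N -> w i \in `[0, 1] /\ `|w i - u| <= N.+2%:R^-1) ->
  contracting (Q \o w) N (1 - N.+2%:R^-1).
suff [N _ /(_ N (leqnn N)) h] : \forall N \near \oo, `[0, 1]%classic `<=` P N.
  exists N, N.+2%:R^-1, (1 - N.+2%:R^-1); split.
  - by rewrite invr_gt0.
  - by rewrite subr_gt0 gtrBl invr_gt0 ltr0n andbT invf_lt1// ltr1n.
  - move=> u w hu hw; exact: (h u hu w hw).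
have cpt : compact `[0 : R, 1]%classic by exact: segment_compact.
move/compact_near_coveringP : cpt; apply => u0 hu0.
have [m [d [r [d0 r1 h]]]] := local_contraction hu0.
have d20 : 0 < d / 2 by rewrite divr_gt0.
have small (e : R) : 0 < e -> \forall N \near \oo, N.+2%:R^-1 < e.
  move=> e0; exists (Num.bound e^-1) => // N /= hN.
  rewrite invf_plt ?posrE//; apply: lt_le_trans (archi_boundP _) _.
    by rewrite invr_ge0 ltW.
  by rewrite ler_nat; exact: leq_trans hN (ltnW (leqnSn _)).
near=> u N => w hw.
have Nm : (m <= N)%N by near: N; exact: nbhs_infty_ge.
have Nd : N.+2%:R^-1 < d / 2 by near: N; exact: small.
have Nr : N.+2%:R^-1 < 1 - r by near: N; apply: small; rewrite subr_gt0.
have ud : `|u0 - u| < d / 2.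
  by near: u; apply/nbhs_ballP; exists (d / 2).
move: (N.+2%:R^-1) hw Nd Nr => e hw Nd Nr.
rewrite -(subnKC Nm); move=> v v0.
apply: (@le_trans _ _ (r * l1norm v)).
  apply: (@contracting_add _ _ (Q \o w) m) => // [i im|].
    by apply: hQ; apply: (hw _ _).1; rewrite -ltn_subRL.
  apply: h => i im; have [wi wiu] := hw i (leq_trans im Nm); split=> //.
  rewrite distrC in ud.
  have -> : w i - u0 = (w i - u) + (u - u0) by ring.
  by apply: le_lt_trans (ler_normD _ _) _; lra.
by rewrite ler_wpM2r ?l1norm_ge0//; lra.
Unshelve. all: by end_near. Qed.

(* After time n the array sits at c, which is a jump to c at each step; with
   this convention it is a Markov chain over all times. *)
Definition array_kernel (c : E) (n : nat) (k : int) : E -> E -> R :=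
  if k <= n%:Z then Q (clip (k%:~R / n%:R)) else fun _ y => (y == c)%:R.

Lemma array_kernel_transition c n k : (0 < n)%N ->
  is_transition (array_kernel c n k).
Proof.
move=> n0; rewrite /array_kernel; case: ifPn => kn.
  by apply: hQ; exact: mem_unit_clip_ratio.
split=> [x y|x]; first by rewrite ler0n.
by rewrite (bigD1 c)//= eqxx big1 ?addr0// => y /negPf ->.
Qed.

(* If n is large, the parameters k / n within a block of bounded length are
   nearly equal; if n is small, a long enough block starts with many steps at
   negative times, which all use Q_0. *)
Lemma array_block_contraction c : exists (M : nat) (r : R),
  [/\ (0 < M)%N, 0 < r < 1 & forall (n : nat) (k : int), (0 < n)%N ->
    contracting (fun i => array_kernel c n (k + i%:Z)) M r].
Proof.
have [N [d [r [d0 r01 h]]]] := uniform_contraction.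
(* For n >= n0, N steps of length 1/n move the parameter by at most d. For n < n0, the n0 extra
   steps of a block ending by time n force its first N steps to negative times. *)
pose n0 := (Num.bound (N%:R / d)).+1.
have Nn0 : N%:R / n0%:R <= d.
  rewrite ler_pdivrMr ?ltr0n// mulrC -ler_pdivrMr//.
  apply: le_trans (ltW (archi_boundP _)) _; first by rewrite divr_ge0// ltW.
  by rewrite ler_nat.
exists (N + n0)%N, r; split=> // [|n k n_gt0]; first by rewrite /n0; lia.
have [kn|nk] := leP (k + (N + n0)%:Z - 1) n%:Z; last first.
  (* The block ends after time n, so its last kernel has equal rows and sends vectors of mass 0 to
     0. Defining [n0] as a successor exposes that kernel. *)
  move=> v v0; rewrite /n0 addnS /= /array_kernel ifF; last lia.
  rewrite (_ : push _ _ = cst 0); last first.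
    apply/funext => y; rewrite /push -mulr_suml evolve_sum ?v0 ?mul0r//.
    by move=> i _; exact: array_kernel_transition.
  have /andP[/ltW r0 _] := r01; rewrite [leLHS]big1 ?mulr_ge0 ?l1norm_ge0//.
  by move=> x _; rewrite normr0.
apply: contracting_add; first by move=> i _; exact: array_kernel_transition.
pose w (i : nat) := clip ((k + i%:Z)%:~R / n%:R : R).
have kin i : (i < N)%N -> k + i%:Z <= n%:Z by rewrite /n0 in kn; lia.
apply: (@eq_contracting _ _ (Q \o w)).
  by move=> i iN; rewrite /array_kernel kin.
have [nn0|nn0] := leqP n0 n.
  apply: (h (clip (k%:~R / n%:R))).
    by apply: mem_unit_clip_ratio => //; rewrite /n0 in kn; lia.
  move=> i iN; split; first exact: mem_unit_clip_ratio (kin i iN).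
  apply: le_trans (clip_dist _ _) _.
  rewrite -mulrBl -intrB addrAC subrr add0r normrM normfV !normr_nat.
  apply: le_trans Nn0; rewrite ler_pM ?invr_ge0//.
    by rewrite ler_nat ltnW.
  by rewrite lef_pV2 ?posrE ?ltr0n// ler_nat.
apply: (h 0); first by rewrite in_itv/= lexx ler01.
move=> i iN; have -> : w i = 0.
  rewrite /w /clip max_l// pmulr_lle0 ?invr_gt0 ?ltr0n//.
  rewrite lerz0; lia.
by rewrite subrr normr0 ltW// in_itv/= lexx ler01.
Qed.

End Family.

(** * Marginals of the array compared with invariant probabilities *)

Definition prob_vector (R : realType) (T : finType) (v : T -> R) : Prop :=
  (forall x, 0 <= v x) /\ \sum_x v x = 1.

Lemma l1norm_prob_sub (R : realType) (T : finType) (v w : T -> R) :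
  prob_vector v -> prob_vector w -> l1norm (v \- w) <= 2.
Proof.
move=> [v0 v1] [w0 w1]; apply: le_trans (l1norm_sub_le _ _) _.
by rewrite !l1norm_prob.
Qed.

(** The kernel [q k] leads from time k - 1 to time k, so the first one after time k is
    [q (k + 1)]. *)
Lemma marginal_evolve (R : realType) (E : finType) (q : int -> E -> E -> R)
    (mu : int -> E -> R) :
  (forall k, mu k = push (mu (k - 1)) (q k)) ->
  forall k m, mu (k + m%:Z) = evolve (mu k) (fun i => q (k + 1 + i%:Z)) m.
Proof.
move=> hmu k; elim=> [|m IH] /=; first by rewrite addr0.
rewrite -IH hmu; congr (push (mu _) (q _)); lia.
Qed.

Section Estimates.
Variables (R : realType) (E : finType) (Q : R -> E -> E -> R) (kappa : R).
Hypothesis hQ : forall u : R, u \in `[0, 1] -> is_transition (Q u).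
Hypothesis hkappa : 0 < kappa < 1.
Hypothesis hholder : forall x y, holder_on_unit kappa (fun u => Q u x y).
Hypothesis hirr : forall u : R, u \in `[0, 1] -> irreducible (Q u).
Hypothesis haper : forall u : R, u \in `[0, 1] -> aperiodic (Q u).

Lemma unique_invariant (u : R) (c : E) : u \in `[0, 1] ->
  exists! p : pmf R E, invariant_prob (Q u) p.
Proof.
move=> hu; have [N [d [r [d0 /andP[r0 r1] h]]]] :=
  uniform_contraction hQ hkappa hholder hirr haper.
have [p pP] := exists_invariant (hQ hu) c.
exists p; split=> // q qP.
have sum1 (s : pmf R E) : \sum_x s x = 1.
  by case: s => f /= /andP[_ /eqP].
have hc : contracting (fun=> Q u) N r.
  by apply: (h u (fun=> u)) => // i _; rewrite subrr normr0 ltW.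
apply/val_inj/ffunP => x.
have : (p : E -> R) = q.
  apply: (contracting_unique hc r1); first by rewrite !sum1.
    by apply/funext => y; rewrite -[RHS]pP.
  by apply/funext => y; rewrite -[RHS]qP.
by move/(congr1 (fun f => f x)).
Qed.

(** As p = p Q_u^N and q = q Q_v^N, the difference p - q is the sum of (p - q) Q_u^N, which is
    contracted, and q (Q_u^N - Q_v^N), at most N Hölder errors; solving for the norm divides by 1 -
    r. *)
Lemma invariant_holder : exists2 A : R, 0 < A &
  forall (u v : R) (p q : E -> R), u \in `[0, 1] -> v \in `[0, 1] ->
    prob_vector p -> prob_vector q -> push p (Q u) = p -> push q (Q v) = q ->
    l1norm (p \- q) <= A * `|u - v| `^ kappa.
Proof.
have [N [d [r [d0 /andP[r0 r1] h]]]] :=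
  uniform_contraction hQ hkappa hholder hirr haper.
have [G G0 hG] := holder_rows hholder.
exists (N.+1%:R * G / (1 - r)).
  by rewrite divr_gt0 ?mulr_gt0 ?ltr0n// subr_gt0.
move=> u v p q hu hv [p0 p1] [q0 q1] pE qE.
have hc : contracting (fun=> Q u) N r.
  by apply: (h u (fun=> u)) => // i _; rewrite subrr normr0 ltW.
set a := G * `|u - v| `^ kappa.
have a0 : 0 <= a by rewrite mulr_ge0 ?powR_ge0// ltW.
have le1 : l1norm (p \- q) <= r * l1norm (p \- q) + N%:R * a.
  rewrite -{1}(evolve_invariant N pE) -{1}(evolve_invariant N qE).
  apply: le_trans (l1norm_triangle _ (evolve q (fun=> Q u) N) _) _.
  rewrite -evolveB lerD//; first by apply: hc; rewrite sumrB p1 q1 subrr.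
  have -> : N%:R * a = N%:R * a * l1norm q by rewrite l1norm_prob// mulr1.
  apply: evolve_dist => // [i _|i _|i x _]; [exact: hQ|exact: hQ|].
  exact: hG.
have -> : N.+1%:R * G / (1 - r) * `|u - v| `^ kappa = N.+1%:R * a / (1 - r).
  by rewrite /a mulrAC mulrA.
rewrite ler_pdivlMr ?subr_gt0//.
apply: (@le_trans _ _ (N%:R * a)); first by lra.
by rewrite ler_wpM2r// ler_nat.
Qed.

(* At time k the chain forgets its past at a geometric rate, so iterating the
   one-block inequality towards -oo leaves only the Hölder error, summed
   against the geometric weights. *)
Lemma marginal_distance (c : E) : exists A B : R, [/\ 0 < A, 0 < B &
  forall (n : nat) (u : R) (mu : int -> E -> R) (p : E -> R) (k : int),
    (0 < n)%N -> u \in `[0, 1] ->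
    (forall l, prob_vector (mu l)) ->
    (forall l, mu l = push (mu (l - 1)) (array_kernel Q c n l)) ->
    prob_vector p -> push p (Q u) = p -> k <= n%:Z ->
    l1norm (mu k \- p) <=
      A * `|u - clip (k%:~R / n%:R)| `^ kappa + B / n%:R `^ kappa].
Proof.
have [M [r [M0 /andP[r0 r1] h]]] :=
  array_block_contraction hQ hkappa hholder hirr haper c.
have [G G0 hG] := holder_rows hholder.
have /andP[k0 k1] := hkappa.
pose g := M%:R * G; pose D : R := M%:R `^ kappa.
have g0 : 0 < g by rewrite mulr_gt0// ltr0n.
have D0 : 0 < D by rewrite powR_gt0// ltr0n.
have r10 : 0 < 1 - r by rewrite subr_gt0.
(* These are the fixed points of the block recursion: A = r A + g and B = r B + r A D + g D, where D
   / n^kappa = (M / n)^kappa is the cost of moving the time by at most M. *)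
pose A := g / (1 - r); pose B := (r * A * D + g * D) / (1 - r).
have A0 : 0 < A by rewrite divr_gt0.
have B0 : 0 < B.
  by apply: divr_gt0 => //; apply: addr_gt0; do 2?[apply: mulr_gt0 => //].
exists A, B; split=> // n u mu p k n0 hu mu1 muE [p0 p1] pE kn.
have nk0 : 0 < (n%:R : R) `^ kappa by rewrite powR_gt0// ltr0n.
pose hh (l : int) := `|u - clip (l%:~R / n%:R)| `^ kappa.
have hh_shift l m : (m <= M)%N ->
    hh (l - m%:Z) <= hh l + D / n%:R `^ kappa.
  move=> mM; apply: (@le_trans _ _ ((`|u - clip (l%:~R / n%:R)|
      + M%:R / n%:R) `^ kappa)).
    apply: ge0_ler_powR; rewrite ?nnegrE ?addr_ge0 ?divr_ge0// ?(ltW k0)//.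
    have -> : u - clip ((l - m%:Z)%:~R / n%:R) = (u - clip (l%:~R / n%:R))
        + (clip (l%:~R / n%:R) - clip ((l - m%:Z)%:~R / n%:R)) by ring.
    apply: le_trans (ler_normD _ _) _; rewrite lerD2l.
    apply: le_trans (clip_dist _ _) _.
    rewrite -mulrBl -intrB opprB addrC subrK normrM normfV !normr_nat.
    by rewrite ler_wpM2r ?invr_ge0// ler_nat.
  apply: le_trans (powR_subadditive _ _ _) _ => //.
    by rewrite k0 ltW.
  by rewrite lerD2l powRM ?invr_ge0// powRV// ltr0n.
have step l : l <= n%:Z -> l1norm (mu l \- p) <=
    r * l1norm (mu (l - M%:Z) \- p) + g * (hh l + D / n%:R `^ kappa).
  move=> ln; pose a := G * (hh l + D / n%:R `^ kappa).
  have a0 : 0 <= a.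
    by rewrite mulr_ge0 ?addr_ge0 ?powR_ge0 ?divr_ge0 ?powR_ge0// ltW.
  pose q i := array_kernel Q c n (l - M%:Z + 1 + i%:Z).
  have -> : mu l = evolve (mu (l - M%:Z)) q M.
    by rewrite -marginal_evolve// subrK.
  rewrite -{1}(evolve_invariant M pE).
  apply: le_trans (l1norm_triangle _ (evolve p q M) _) _.
  rewrite -evolveB lerD//.
    by apply: h => //; rewrite sumrB (mu1 _).2 p1 subrr.
  rewrite /g -mulrA -/a.
  have -> : M%:R * a = M%:R * a * l1norm p by rewrite l1norm_prob// mulr1.
  apply: evolve_dist => // [i _|i _|i x iM].
  - exact: array_kernel_transition.
  - exact: hQ.
  have qn : l - M%:Z + 1 + i%:Z <= n%:Z by clear -ln iM; lia.
  rewrite /q /array_kernel qn.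
  under eq_bigr do rewrite distrC.
  apply: le_trans (hG _ _ _ hu (mem_unit_clip_ratio R n0 qn)) _.
  rewrite ler_wpM2l ?(ltW G0)//.
  have -> : l - M%:Z + 1 + i%:Z = l - (M - i.+1)%N%:Z by clear -iM; lia.
  by apply: hh_shift; exact: leq_subr.
suff bound m : forall l, l <= n%:Z -> l1norm (mu l \- p) <=
    r ^+ m * 2 + (A * hh l + B / n%:R `^ kappa).
  rewrite -/(hh k); set z := A * hh k + _; apply/ler_addgt0Pl => e e0.
  have [m rm] : exists m, r ^+ m * 2 < e.
    have : (fun m => r ^+ m * 2) @ \oo --> (0 * 2 : R).
      by apply: cvgMl; apply: cvg_expr; rewrite ger0_norm// ltW.
    rewrite mul0r => /cvgrPdist_lt/(_ _ e0)[m _ hm]; exists m.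
    have := hm m (leqnn m); rewrite sub0r normrN.
    exact: le_lt_trans (ler_norm _).
  by apply: le_trans (bound m k kn) _; rewrite lerD2r ltW.
elim: m => [l ln|m IH l ln].
  rewrite expr0 mul1r; apply: le_trans (l1norm_prob_sub (mu1 l) (conj p0 p1)) _.
  rewrite lerDl; apply: addr_ge0.
    by rewrite mulr_ge0 ?powR_ge0// ltW.
  by rewrite divr_ge0 ?powR_ge0// ltW.
apply: le_trans (step l ln) _.
have lM : l - M%:Z <= n%:Z by clear -ln; lia.
apply: (@le_trans _ _ (r * (r ^+ m * 2 + (A * (hh l + D / n%:R `^ kappa)
    + B / n%:R `^ kappa)) + g * (hh l + D / n%:R `^ kappa))).
  rewrite lerD2r ler_wpM2l ?(ltW r0)//.
  apply: le_trans (IH _ lM) _; rewrite lerD2l lerD2r ler_wpM2l ?(ltW A0)//.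
  exact: hh_shift.
rewrite exprS le_eqVlt; apply/orP; left; apply/eqP.
rewrite /B /A; field; rewrite !gt_eqF//.
Qed.

End Estimates.

(** * Laws of Markov chains *)

Section PathWeight.
Variables (R : realType) (E : finType).
Implicit Types (v : E -> R) (q : nat -> E -> E -> R).

Fixpoint path_weight v q (s : seq E) : R :=
  if s is x :: s' then v x * path_weight (q 0%N x) (q \o S) s' else 1.

Lemma path_weight_rcons v q x s y :
  path_weight v q (rcons (x :: s) y) =
  path_weight v q (x :: s) * q (size s) (last x s) y.
Proof.
elim: s x v q => [|z s IH] x v q /=; first by rewrite !mulr1.
by have /= -> := IH z (q 0%N x) (q \o S); rewrite mulrA.
Qed.

Lemma path_weight_ge0 v q s : (forall x, 0 <= v x) ->
  (forall i, is_transition (q i)) -> 0 <= path_weight v q s.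
Proof.
elim: s v q => //= x s IH v q v0 hq; apply: mulr_ge0 => //.
by apply: IH => [|i]; [exact: (hq _).1|exact: hq].
Qed.

Lemma sum_tuple_cons j (F : j.+1.-tuple E -> R) :
  \sum_t F t = \sum_x \sum_(t : j.-tuple E) F [tuple of x :: t].
Proof.
rewrite pair_big (reindex (fun p : E * j.-tuple E => [tuple of p.1 :: p.2]))//=.
exists (fun t : j.+1.-tuple E => (thead t, [tuple of behead t]))
  => [[x t] _|t _].
  by congr pair; exact/val_inj.
by rewrite /= -tuple_eta.
Qed.

Lemma path_weight_sum j v q : prob_vector v ->
  (forall i, is_transition (q i)) ->
  \sum_(t : j.-tuple E) path_weight v q t = 1.
Proof.
elim: j v q => [|j IH] v q [v0 v1] hq.
  rewrite (eq_bigr (fun=> 1)); last by move=> t _; rewrite tuple0.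
  by rewrite sumr_const card_tuple expn0.
rewrite sum_tuple_cons -v1; apply: eq_bigr => x _ /=.
rewrite -mulr_sumr IH ?mulr1//.
  by split; [exact: (hq _).1|exact: (hq _).2].
by move=> i; exact: hq.
Qed.

(** With p, p' the weights of the path after its first state, v p - v' p' = (v - v') p + v' (p -
    p'). The first term sums to the initial distance, since p has mass 1; the second is a v'-average
    of distances between shorter paths, whose initial vectors are rows of [q 0] and [q' 0] at
    distance at most [a 0]. *)
Lemma path_weight_dist j v v' q q' (a : nat -> R) :
  prob_vector v -> prob_vector v' ->
  (forall i, is_transition (q i)) -> (forall i, is_transition (q' i)) ->
  (forall i x, (i < j)%N -> \sum_y `|q i x y - q' i x y| <= a i) ->
  \sum_(t : j.+1.-tuple E) `|path_weight v q t - path_weight v' q' t|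
    <= l1norm (v \- v') + \sum_(i < j) a i.
Proof.
elim: j v v' q q' a => [|j IH] v v' q q' a hv hv' hq hq' ha.
  rewrite sum_tuple_cons big_ord0 addr0; apply: ler_sum => x _ /=.
  rewrite (eq_bigr (fun=> `|v x - v' x|)).
    by rewrite sumr_const card_tuple expn0.
  by move=> t _; rewrite tuple0 /= !mulr1.
have row (r : nat -> E -> E -> R) i x : (forall i, is_transition (r i)) ->
    prob_vector (r i x).
  by move=> hr; split; [exact: (hr _).1|exact: (hr _).2].
have tail x : \sum_(t : j.+1.-tuple E)
    `|path_weight (q 0%N x) (q \o S) t - path_weight (q' 0%N x) (q' \o S) t|
    <= \sum_(i < j.+1) a i.
  apply: le_trans (IH _ _ _ _ (a \o S) _ _ _ _ _) _;
    [exact: row|exact: row| | | |].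
  - by move=> i; exact: hq.
  - by move=> i; exact: hq'.
  - by move=> i y ij; exact: ha.
  by rewrite big_ord_recl lerD2r; exact: ha.
rewrite sum_tuple_cons.
apply: (@le_trans _ _ (\sum_x (`|v x - v' x| + v' x * \sum_(i < j.+1) a i))).
  apply: ler_sum => x _.
  apply: (@le_trans _ _ (\sum_(t : j.+1.-tuple E)
    (`|v x - v' x| * path_weight (q 0%N x) (q \o S) t + v' x *
    `|path_weight (q 0%N x) (q \o S) t - path_weight (q' 0%N x) (q' \o S) t|))).
    apply: ler_sum => t _ /=.
    set p := path_weight _ _ _; set p' := path_weight _ _ _.
    have -> : v x * p - v' x * p' = (v x - v' x) * p + v' x * (p - p') by ring.
    apply: le_trans (ler_normD _ _) _; rewrite !normrM.
    rewrite (ger0_norm (hv'.1 x)) [`|p|]ger0_norm//.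
    by apply: path_weight_ge0; [exact: (row _ _ _ hq).1|move=> i; exact: hq].
  rewrite big_split -!mulr_sumr /= path_weight_sum; last 2 first.
  - exact: row.
  - by move=> i; exact: hq.
  by rewrite mulr1 lerD2l ler_wpM2l ?hv'.1.
by rewrite big_split -mulr_suml hv'.2 mul1r.
Qed.

End PathWeight.

Section MarkovProduct.
Variables (R : realType) (E : finType) (X : process R E).
Implicit Types (q : int -> E -> E -> R) (k : int).

(* x lists the states backwards in time, starting from time k. *)
Definition cylinder k (m : nat) (x : nat -> E) : set (process_space X) :=
  [set w | forall i : nat, (i <= m)%N -> X (k - i%:Z) w = x i].

(* Multiplying out the conditional probabilities makes pasts of probability 0
   harmless. *)
Definition markov_product q : Prop := forall k m x y,
  pr (X k @^-1` [set y] `&` cylinder (k - 1) m x) =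
  pr (cylinder (k - 1) m x) * q k (x 0%N) y.

Definition marginal k : E -> R := fun y => pr (X k @^-1` [set y]).

Lemma measurable_preimage k (B : set E) : measurable (X k @^-1` B).
Proof.
have -> : X k @^-1` B = \bigcup_(y in B) (X k @^-1` [set y]).
  apply/seteqP; split=> [w Bw|w [y By /= wy]]; last by rewrite /= wy.
  by exists (X k w); [exact: Bw|].
by apply: fin_bigcup_measurable => // y _; exact: process_meas.
Qed.

Lemma cylinderS k m x :
  cylinder k m.+1 x = X k @^-1` [set x 0%N] `&` cylinder (k - 1) m (x \o S).
Proof.
apply/seteqP; split=> w.
  move=> h; split; first by have := h 0%N (leq0n _); rewrite subr0.
  move=> i im; rewrite /= -(h i.+1)//; congr (X _ w); lia.
move=> [/= w0 h] [|i] im; first by rewrite subr0.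
by have /= <- := h i im; congr (X _ w); lia.
Qed.

Lemma cylinder0 k x : cylinder k 0 x = X k @^-1` [set x 0%N].
Proof.
apply/seteqP; split=> w; first by move=> /(_ 0%N (leqnn _)); rewrite subr0.
by move=> /= w0 [|i]// _; rewrite subr0.
Qed.

Lemma measurable_cylinder k m x : measurable (cylinder k m x).
Proof.
elim: m k x => [|m IH] k x; first by rewrite cylinder0; exact: process_meas.
by rewrite cylinderS; apply: measurableI => //; exact: process_meas.
Qed.

Lemma pr_ge0 (A : set (process_space X)) : 0 <= pr A.
Proof. by rewrite /pr fine_ge0. Qed.

Lemma prE (A : set (process_space X)) : measurable A ->
  process_prob X A = (pr A)%:E.
Proof. by move=> mA; rewrite /pr fineK// fin_num_measure. Qed.

Lemma le_pr (A B : set (process_space X)) :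
  measurable A -> measurable B -> A `<=` B -> pr A <= pr B.
Proof. by move=> mA mB AB; rewrite -lee_fin -!prE// le_measure// inE. Qed.

Lemma pr_split k (A : set (process_space X)) : measurable A ->
  pr A = \sum_y pr (X k @^-1` [set y] `&` A).
Proof.
move=> mA; apply: EFin_inj; rewrite -sumEFin -prE//.
have mI y : measurable (X k @^-1` [set y] `&` A).
  by apply: measurableI => //; exact: process_meas.
under eq_bigr do rewrite -prE//.
rewrite (fsbig_seq _ _ (index_enum_uniq _)) -measure_fin_bigcup.
- congr (process_prob X _); apply/seteqP; split=> [w Aw|w [y _ []]//].
  by exists (X k w) => //=; rewrite mem_index_enum.
- exact: finite_seq.
- by move=> x y _ _ [w [[/= <- _] [/= <- _]]].
- by [].
Qed.

Lemma prT : pr [set: process_space X] = 1.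
Proof. by rewrite /pr probability_setT. Qed.

Lemma marginal_prob k : prob_vector (marginal k).
Proof.
split=> [y|]; first exact: pr_ge0.
rewrite -prT (pr_split k)//.
by apply: eq_bigr => y _; rewrite setIT.
Qed.

(** Agreement of q and q' at the one time k suffices, so a chain that is Markov only up to time n
    can be matched with [array_kernel]. *)
Lemma markov_product_chain (D : set int) q q' k m x y :
  markov_chain X D q -> D k -> q k = q' k ->
  pr (X k @^-1` [set y] `&` cylinder (k - 1) m x) =
  pr (cylinder (k - 1) m x) * q' k (x 0%N) y.
Proof.
move=> hX Dk <-; have [h1 h2] := hX k Dk.
have mC := measurable_cylinder (k - 1) m x.
have mX l z : measurable (X l @^-1` [set z]) by exact: process_meas.
have [C0|C0] := ltP 0 (pr (cylinder (k - 1) m x)).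
  have := h1 m x y C0; rewrite h2; last first.
    apply: lt_le_trans C0 _; apply: le_pr => // w /(_ 0%N (leq0n _)).
    by rewrite subr0.
  rewrite /cond_pr -/(cylinder (k - 1) m x) => <-.
  by rewrite mulrC divfK// gt_eqF.
have /eqP -> : pr (cylinder (k - 1) m x) == 0 by rewrite eq_le C0 pr_ge0.
rewrite mul0r; apply/eqP; rewrite eq_le pr_ge0 andbT; apply: le_trans C0.
by apply: le_pr => //; exact: measurableI.
Qed.

Section Product.
Variable q : int -> E -> E -> R.
Hypothesis hX : markov_product q.

Lemma marginal_push k : marginal k = push (marginal (k - 1)) (q k).
Proof.
apply/funext => y; rewrite /marginal (pr_split (k - 1)); last first.
  exact: process_meas.
by apply: eq_bigr => x _; rewrite setIC -(cylinder0 _ (fun=> x)) hX.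
Qed.

(** The row at x of the transition matrix from time k to time k + j. *)
Definition transition_from k (j : nat) (x : E) : E -> R :=
  evolve (fun z => (x == z)%:R) (fun i => q (k + 1 + i%:Z)) j.

(** Splitting on the state at time k + 1 and adding it to the past leaves one future step less;
    hence the induction ranges over all times and pasts. *)
Lemma pr_future_cylinder j k m x y :
  pr (X (k + j%:Z) @^-1` [set y] `&` cylinder k m x) =
  pr (cylinder k m x) * transition_from k j (x 0%N) y.
Proof.
elim: j k m x => [|j IH] k m x.
  rewrite addr0 /transition_from /=; case: eqVneq => [<-|xy].
    rewrite mulr1; congr pr; apply: setIidr => w /(_ 0%N (leq0n _)).
    by rewrite subr0.
  rewrite mulr0 (_ : _ `&` _ = set0) ?/pr ?measure0//.
  apply/seteqP; split=> // w [/= wy /(_ 0%N (leq0n _))].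
  by rewrite subr0 wy => /esym/eqP; rewrite (negPf xy).
have mC := measurable_cylinder.
rewrite (pr_split (k + 1)); last first.
  by apply: measurableI => //; exact: process_meas.
rewrite /transition_from evolveSl evolve_delta mulr_sumr.
apply: eq_bigr => z _.
pose x' i := if i is i'.+1 then x i' else z.
have cE : X (k + 1) @^-1` [set z] `&` cylinder k m x = cylinder (k + 1) m.+1 x'.
  by rewrite cylinderS addrK.
rewrite setICA cE (_ : k + j.+1%:Z = k + 1 + j%:Z); last lia.
rewrite IH -cE -{2}(addrK 1 k) hX addrK -mulrA; congr (_ * _).
rewrite /= {1}/push (bigD1 (x 0%N))//= eqxx mul1r big1 ?addr0; last first.
  by move=> w; rewrite eq_sym => /negPf ->; rewrite mul0r.
congr (_ * _); rewrite /transition_from; congr (evolve _ _ _ _).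
by apply/funext => i /=; congr q; lia.
Qed.

(** The induction is on the last state because [markov_product] extends a path at its end; [r]
    reverses the path to make it a cylinder. *)
Lemma pr_path k x s :
  pr [set w | forall i : nat,
        (i <= size s)%N -> X (k + i%:Z) w = nth x (x :: s) i] =
  path_weight (marginal k) (fun i => q (k + 1 + i%:Z)) (x :: s).
Proof.
elim/last_ind: s => [|s y IH].
  rewrite /= mulr1 /marginal; congr pr; apply/seteqP; split=> w.
    by move=> /(_ 0%N (leqnn _)); rewrite addr0.
  by move=> /= wx [|i]// _; rewrite addr0.
rewrite -rcons_cons path_weight_rcons -IH.
pose r i := nth x (x :: s) (size s - i).
have cE : [set w | forall i : nat, (i <= size s)%N ->
    X (k + i%:Z) w = nth x (x :: s) i] =
    cylinder (k + 1 + (size s)%:Z - 1) (size s) r.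
  apply/seteqP; split=> w h i im.
    by rewrite /r -h ?leq_subr//; congr (X _ w); lia.
  have := h (size s - i)%N (leq_subr _ _); rewrite /r subKn// => <-.
  by congr (X _ w); lia.
rewrite cE -[last x s](_ : r 0%N = _); last by rewrite /r subn0 -last_nth.
rewrite -hX -cE; congr pr; apply/seteqP; split=> w.
  move=> h; split=> /=.
    have := h (size s).+1; rewrite size_rcons => /(_ (leqnn _)).
    rewrite nth_rcons /= ltnn eqxx => <-; congr (X _ w); lia.
  move=> i im; rewrite h ?size_rcons ?leqW//.
  by rewrite nth_rcons /= ltnS im.
move=> [hy h] i; rewrite size_rcons leq_eqVlt => /predU1P[->|im].
  rewrite nth_rcons /= ltnn eqxx -hy; congr (X _ w); lia.
by rewrite nth_rcons /= im h.
Qed.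

Lemma law_path k j (t : j.+1.-tuple E) :
  law X k j.+1 t = path_weight (marginal k) (fun i => q (k + 1 + i%:Z)) t.
Proof.
rewrite /= ffunE; case: (tupleP t) => x s.
rewrite -(pr_path k x s); congr pr; apply/seteqP; split=> w.
  move=> /= wt i; rewrite size_tuple => ij.
  have := congr1 (fun u => tnth u (Ordinal (n := j.+1) (m := i) ij)) wt.
  by rewrite tnth_mktuple (tnth_nth x).
move=> h; apply: eq_from_tnth => i; rewrite tnth_mktuple (tnth_nth x) /=.
by apply: h; rewrite size_tuple -ltnS.
Qed.

End Product.

End MarkovProduct.

(** * Conditioning on the past and mixing *)

Section ConditionalLaw.
Variables (R : realType) (E : finType) (X : process R E).
Variable q : int -> E -> E -> R.
Hypothesis hX : markov_product X q.
Hypothesis hq : forall k, is_transition (q k).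

Notation P := (process_prob X).

Lemma transition_from_ge0 k j x y : 0 <= transition_from q k j x y.
Proof.
rewrite /transition_from; elim: j y => [|j IH] y /=; first by rewrite ler0n.
by apply: sumr_ge0 => z _; rewrite mulr_ge0 ?(hq _).1.
Qed.

(** An event on X_l with l = i - m is a finite union of cylinders reaching back m steps, those whose
    oldest state lies in B. *)
Lemma past_sub_cylinders i A : <<s past_gen (X := X) i >> A ->
  <<s [set B | [\/ B = set0, B = setT |
               exists m x, B = cylinder (X := X) i m x] ] >> A.
Proof.
set G := [set B | _]; move: A; apply: smallest_sub.
  exact: smallest_sigma_algebra.
move=> A [l [B [li ->]]].
have [m lE] : exists m : nat, l = i - m%:Z by exists `|i - l|%N; lia.
pose ext (f : {ffun 'I_m.+1 -> E}) (a : nat) := f (inord a).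
have -> : X l @^-1` B =
    \bigcup_(f in [set f : {ffun 'I_m.+1 -> E} | B (f ord_max)])
      cylinder (X := X) i m (ext f).
  apply/seteqP; split=> [w Bw|w [f /= Bf /(_ m (leqnn m))]].
    exists [ffun a : 'I_m.+1 => X (i - (a : nat)%:Z) w].
      by rewrite /= ffunE /= -lE; exact: Bw.
    by move=> a am; rewrite /ext ffunE inordK.
  rewrite -lE /ext => /= ->.
  by rewrite (_ : inord m = ord_max)//; apply/val_inj; rewrite /= inordK.
have mG f : <<s G >> (cylinder (X := X) i m (ext f)).
  by apply: sub_gen_smallest; apply: Or33; exists m, (ext f).
apply: (@fin_bigcup_measurable _ (g_sigma_algebraType G)) => // f _.
exact: mG.
Qed.

(** Cylinders based at the same time are nested or disjoint, whence the empty set in the class; the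
    whole space serves as exhausting sequence when measures are identified. *)
Lemma cylinders_setI i : setI_closed
  [set B | [\/ B = set0, B = setT | exists m x, B = cylinder (X := X) i m x] ].
Proof.
move=> A B [->|->|[m [x ->]]]; first by rewrite set0I => _; apply: Or31.
  by rewrite setTI.
move=> [->|->|[m' [x' ->]]]; first by rewrite setI0; apply: Or31.
  by rewrite setIT; apply: Or33; exists m, x.
wlog mm' : m x m' x' / (m <= m')%N.
  move=> h; have [mm'|/ltnW mm'] := leqP m m'; first exact: h.
  by rewrite setIC; exact: h.
have [xx'|/existsNP[a /not_implyP[am xa]]] :=
    pselect (forall a, (a <= m)%N -> x a = x' a).
  apply: Or33; exists m', x'; apply/seteqP; split=> [w []//|w h].
  by split=> // a am; rewrite h ?xx'//; exact: leq_trans mm'.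
apply: Or31; apply/seteqP; split=> // w [h h']; apply: xa.
by rewrite -(h a am) -(h' a (leq_trans am mm')).
Qed.

Lemma measurable_past i : <<s past_gen (X := X) i >> `<=` measurable.
Proof.
apply: smallest_sub; first exact: sigma_algebra_measurable.
by move=> A [l [B [_ ->]]]; exact: measurable_preimage.
Qed.

(** Fixing the state x at time i makes the transition factor constant, so both sides are finite
    measures in A; they agree on the pi-system of cylinders, hence on the sigma-algebra it
    generates. *)
Lemma pr_future_past i j x y A : <<s past_gen (X := X) i >> A ->
  pr (X (i + j%:Z) @^-1` [set y] `&` (X i @^-1` [set x] `&` A)) =
  pr (X i @^-1` [set x] `&` A) * transition_from q i j x y.
Proof.
move=> pA; have mA := measurable_past pA; move/past_sub_cylinders : pA.
set G := [set B | _] => GA.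
pose Bx := X i @^-1` [set x]; pose By := X (i + j%:Z) @^-1` [set y].
have mx : measurable Bx by exact: process_meas.
have mxy : measurable (By `&` Bx).
  by apply: measurableI => //; exact: process_meas.
have mG : G `<=` measurable.
  by move=> _ [->|->|[m [z ->]]] //; exact: measurable_cylinder.
pose t : {nonneg R} := NngNum (transition_from_ge0 i j x y).
have key B : G B -> mrestr P mxy B = mscale t (mrestr P mx) B.
  move=> GB; have mB := mG _ GB.
  have mB1 : measurable (B `&` (By `&` Bx)) by exact: measurableI.
  have mB2 : measurable (B `&` Bx) by exact: measurableI.
  rewrite /mscale /= /mrestr !prE// -EFinM /=; congr EFin; rewrite mulrC.
  have split m z : pr (cylinder (X := X) i m z `&` (By `&` Bx)) =
      pr (cylinder (X := X) i m z `&` Bx) * transition_from q i j x y.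
    have [zx|zx] := eqVneq (z 0%N) x.
      have cB : cylinder (X := X) i m z `<=` Bx.
        by move=> w /(_ 0%N (leq0n _)); rewrite subr0 zx.
      rewrite (setIidl cB) setIC -setIA (setIidr cB) setIC.
      by rewrite -zx -(pr_future_cylinder hX) setIC.
    have c0 : cylinder (X := X) i m z `&` Bx = set0.
      apply/seteqP; split=> // w [/(_ 0%N (leq0n _))]; rewrite subr0 => h h'.
      by move/eqP : zx; apply; rewrite -h.
    by rewrite setICA c0 setI0 /pr measure0 mul0r.
  case: GB => [->|->|[m [z ->]]]; last exact: split.
    by rewrite !set0I /pr measure0 mul0r.
  have := split 0%N (fun=> x); rewrite cylinder0 -/Bx setIid !setTI => <-.
  by rewrite setICA setIid.
have cover : \bigcup_(k : nat) (setT : set (process_space X)) = setT.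
  by apply/seteqP; split=> // w _; exists 0%N.
have fin (k : nat) : (mrestr P mxy setT < +oo)%E.
  by rewrite /mrestr setTI prE// ltry.
have := @g_sigma_algebra_measure_unique _ R _ G mG (fun=> setT)
  (fun=> Or32 _ _ erefl) cover (mrestr P mxy) (mscale t (mrestr P mx))
  (@cylinders_setI i) key fin A GA.
have mA1 : measurable (A `&` (By `&` Bx)) by exact: measurableI.
have mA2 : measurable (A `&` Bx) by exact: measurableI.
move=> h; have {h} : mrestr P mxy A = mscale t (mrestr P mx) A by exact: h.
rewrite /mscale /= /mrestr !prE// -EFinM => -[].
by rewrite mulrC [A `&` Bx]setIC setIC setIA => ->.
Qed.

Lemma integral_state k (A : set (process_space X)) (f : E -> R) :
  measurable A ->
  (\int[P]_(w in A) (f (X k w))%:E =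
   (\sum_y f y * pr (X k @^-1` [set y] `&` A))%:E)%E.
Proof.
move=> mA; pose F y := X k @^-1` [set y] `&` A.
have mF y : measurable (F y) by apply: measurableI => //; exact: process_meas.
have mf : measurable_fun setT (f \o X k).
  by move=> _ B mB; rewrite setTI; exact: (measurable_preimage X k (f @^-1` B)).
have AE : A = \big[setU/set0]_(y <- index_enum E) F y.
  rewrite -bigcup_seq; apply/seteqP; split=> [w Aw|w [y _ []]//].
  by exists (X k w) => //=; rewrite mem_index_enum.
rewrite {1}AE integral_bigsetU_EFin//; last 3 first.
- exact: index_enum_uniq.
- by move=> x y _ _ [w [[/= <- _] [/= <- _]]].
- rewrite -AE; apply/measurable_EFinP.
  by apply: measurable_funS mf.
rewrite -sumEFin; apply: eq_bigr => y _.
rewrite (eq_integral (cst (f y)%:E)); last first.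
  by move=> w; rewrite inE => -[/= -> _].
rewrite integral_cst// EFinM; congr (_ * _)%E; exact: prE.
Qed.

End ConditionalLaw.

(** The set where g >= g' and its complement belong to the sigma-algebra; on each, |g - g'| is a
    difference of functions whose integrals both equal that of f. *)
Lemma is_cond_exp_unique (R : realType) (d : measure_display)
    (T : measurableType d) (P : probability T R) (G : set (set T))
    (f g g' : T -> R) : <<s G >> `<=` measurable ->
  is_cond_exp P G f g -> is_cond_exp P G f g' ->
  (\int[P]_w (`|g w - g' w|)%:E = 0)%E.
Proof.
move=> sG [mg ig Eg] [mg' ig' Eg'].
pose A := [set w | 0 <= g w - g' w].
have GA : <<s G >> A.
  have mh := measurable_funB mg mg'.
  have := mh measurableT `[0, +oo[%classic (measurable_itv _).
  rewrite setTI; congr (<<s G >> _).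
  by apply/seteqP; split=> w; rewrite /= in_itv/= andbT.
have GC : <<s G >> (~` A).
  exact: (@measurableC _ (g_sigma_algebraType G) A GA).
have mA := sG _ GA; have mC := sG _ GC.
have iB B (h : T -> R) : measurable B -> P.-integrable setT (EFin \o h) ->
    P.-integrable B (EFin \o h).
  by move=> mB; apply: integrableS.
have m1 : measurable_fun setT (fun w => (`|g w - g' w|)%:E).
  apply/measurable_EFinP; apply: measurableT_comp.
    exact: normr_measurable.
  apply: measurable_funB; apply/measurable_EFinP.
    exact: measurable_int ig.
  exact: measurable_int ig'.
rewrite -(setUv A) ge0_integral_setU ?setUv//; last exact/disj_setPCl.
rewrite (eq_integral (fun w => (g w)%:E - (g' w)%:E)%E); last first.
  by move=> w; rewrite inE /A /= => h; rewrite ger0_norm.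
rewrite (eq_integral (D := ~` A) (fun w => (g' w)%:E - (g w)%:E)%E); last first.
  move=> w; rewrite inE /A /= => /negP; rewrite -ltNge => h.
  by rewrite ltr0_norm// opprB.
have fin B h : measurable B -> P.-integrable setT (EFin \o h) ->
    (\int[P]_(w in B) (h w)%:E)%E \is a fin_num.
  by move=> mB ih; apply: integrable_fin_num => //; exact: iB.
rewrite !integralB_EFin//; try exact: iB.
by rewrite !Eg// !Eg'// !subee ?adde0// -?Eg//; exact: fin.
Qed.

Section BetaBound.
Variables (R : realType) (E : finType) (X : process R E).
Variable q : int -> E -> E -> R.
Hypothesis hX : markov_product X q.
Hypothesis hq : forall k, is_transition (q k).

Notation P := (process_prob X).

Lemma is_cond_exp_transition i j y :
  is_cond_exp P (past_gen i) (\1_(X (i + j%:Z) @^-1` [set y]))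
    (fun w => transition_from q i j (X i w) y).
Proof.
have mX k z : measurable (X k @^-1` [set z]) by exact: process_meas.
split.
- move=> _ B mB; rewrite setTI; apply: sub_gen_smallest.
  by exists i, [set x | B (transition_from q i j x y)].
- apply: measurable_bounded_integrable => //.
  + exact: le_lt_trans (probability_le1 P measurableT) (ltry 1).
  + move=> _ B mB; rewrite setTI.
    exact: (measurable_preimage X i [set x | B (transition_from q i j x y)]).
  + exists (\sum_x `|transition_from q i j x y|); split; first exact: num_real.
    move=> M hM w _ /=; apply: le_trans (ltW hM).
    rewrite (bigD1 (X i w))//= lerDl; exact: sumr_ge0.
- move=> A GA; have mA := measurable_past GA.
  rewrite (integral_state i (fun x => transition_from q i j x y) mA).
  rewrite integral_indic//; transitivity
    (pr (X (i + j%:Z) @^-1` [set y] `&` A))%:E; last first.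
    by apply/esym/prE; exact: measurableI.
  congr EFin; rewrite (pr_split i); last exact: measurableI.
  apply: eq_bigr => x _; rewrite mulrC -(pr_future_past hX hq)//.
  by rewrite setICA.
Qed.

Lemma expectation_state k (f : E -> R) :
  fine ('E_P[f \o X k])%E = \sum_y f y * marginal X k y.
Proof.
rewrite unlock /= (integral_state k f) //=.
by apply: eq_bigr => y _; rewrite setIT.
Qed.

(** Duality of l^1 and l^infinity: the signs of a - b attain the supremum. This replaces the
    uncountable supremum inside [beta] by a finite sum. *)
Lemma sup_unit_ball (a b : E -> R) :
  ereal_sup [set (`|\sum_y f y * a y - \sum_y f y * b y|)%:E
            | f in [set f : E -> R | forall y, `|f y| <= 1]]
  = (\sum_y `|a y - b y|)%:E.
Proof.
have sumE f : \sum_y f y * a y - \sum_y f y * b y = \sum_y f y * (a y - b y).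
  by rewrite -sumrB; apply: eq_bigr => y _; rewrite mulrBr.
apply/eqP; rewrite eq_le; apply/andP; split.
  apply: ge_ereal_sup => _ [f /= f1 <-]; rewrite lee_fin sumE.
  apply: le_trans (ler_norm_sum _ _ _) _; apply: ler_sum => y _.
  by rewrite normrM ler_piMl.
apply: ereal_sup_ubound; exists (fun y => Num.sg (a y - b y)).
  by move=> y /=; rewrite normr_sg lern1 leq_b1.
rewrite sumE; congr EFin.
under eq_bigr do rewrite -normrEsg.
by rewrite ger0_norm// sumr_ge0.
Qed.

Lemma transition_from_mixing i j r x : 0 <= r ->
  contracting (fun l => q (i + 1 + l%:Z)) j r ->
  \sum_y `|transition_from q i j x y - marginal X (i + j%:Z) y| <= r * 2.
Proof.
move=> r0 hc; rewrite -/(l1norm (transition_from q i j x \- _)).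
rewrite (marginal_evolve (marginal_push hX)) -evolveB.
have dx : prob_vector (fun z : E => (x == z)%:R : R).
  split=> [z|]; first by rewrite ler0n.
  by rewrite (bigD1 x)//= eqxx big1 ?addr0// => z; rewrite eq_sym => /negPf ->.
have mp := marginal_prob X i.
apply: le_trans (hc _ _) _; first by rewrite sumrB dx.2 mp.2 subrr.
by rewrite ler_wpM2l// l1norm_prob_sub.
Qed.

(** The version [g] of the conditional law chosen in [beta] is known only almost surely, while
    mixing is a pointwise bound on the kernel version [g0]. The triangle inequality separates them:
    |g - g0| integrates to 0, and the rest is at most 2 r everywhere. *)
Lemma beta_le j r : 0 <= r ->
  (forall i, contracting (fun l => q (i + 1 + l%:Z)) j r) ->
  (beta X j <= r%:E)%E.
Proof.
move=> r0 hc; rewrite /beta.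
suff h : (ereal_sup [set \int[P]_w
     ereal_sup [set (`| cond_exp_past i (i + j%:Z) f w
                         - fine 'E_P[f \o X (i + j%:Z)] |)%:E
                 | f in [set f : E -> R | forall y, (`|f y| <= 1)%R]]
   | i in [set: int]] <= (r * 2)%:E)%E.
  apply: le_trans (lee_wpmul2l _ h) _; first by rewrite lee_fin invr_ge0.
  by rewrite -EFinM lee_fin mulrC mulfK.
apply: ge_ereal_sup => _ [i _ <-].
pose g y := cond_exp P (past_gen i) (\1_(X (i + j%:Z) @^-1` [set y])).
pose g0 y w := transition_from q i j (X i w) y.
have gP y : is_cond_exp P (past_gen i) (\1_(X (i + j%:Z) @^-1` [set y])) (g y).
  by apply: xgetPex; exists (g0 y); exact: is_cond_exp_transition.
have g0P y := is_cond_exp_transition i j y.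
under eq_integral => w _.
  rewrite (_ : ereal_sup _ = (\sum_y `|g y w - marginal X (i + j%:Z) y|)%:E).
    over.
  rewrite -sup_unit_ball; congr ereal_sup; apply: eq_imagel => f _.
  by rewrite expectation_state.
have mint (h : process_space X -> R) : P.-integrable setT (EFin \o h) ->
    measurable_fun setT h.
  by move=> /measurable_int/measurable_EFinP.
have mg y : measurable_fun setT (g y) by have [_ ? _] := gP y; exact: mint.
have mg0 y : measurable_fun setT (g0 y) by have [_ ? _] := g0P y; exact: mint.
have mD y : measurable_fun setT (fun w => (`|g y w - g0 y w|)%:E).
  apply/measurable_EFinP; apply: measurableT_comp.
    exact: normr_measurable.
  exact: measurable_funB.
have mS : measurable_fun setT
    (fun w => \sum_y (`|g y w - g0 y w|)%:E)%E.
  exact: emeasurable_sum.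
apply: (@le_trans _ _ (\int[P]_w
    (\sum_y (`|g y w - g0 y w|)%:E + cst (r * 2)%:E w)))%E.
  apply: ge0_le_integral => //.
  - by move=> w _; rewrite lee_fin sumr_ge0.
  - apply/measurable_EFinP; apply: measurable_sum => y.
    apply: measurableT_comp; first exact: normr_measurable.
    by apply: measurable_funB => //; exact: measurable_cst.
  - by apply: emeasurable_funD => //; exact: measurable_cst.
  move=> w _; rewrite sumEFin -EFinD lee_fin.
  apply: le_trans (lerD (lexx _) (transition_from_mixing (X i w) r0 (hc i))).
  rewrite -big_split; apply: ler_sum => y _ /=.
  have -> : g y w - marginal X (i + j%:Z) y = (g y w - g0 y w) +
      (g0 y w - marginal X (i + j%:Z) y) by ring.
  exact: ler_normD.
rewrite ge0_integralD//; last 2 first.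
- by move=> w _; apply: sume_ge0 => y _; rewrite lee_fin.
- by move=> w _; rewrite lee_fin mulr_ge0.
have -> : (\int[P]_w cst (r * 2)%:E w = (r * 2)%:E)%E.
  rewrite integral_cst// -[RHS]mule1; congr (_ * _)%E; exact: probability_setT.
rewrite ge0_integral_sum// big1 ?add0e// => y _.
exact: is_cond_exp_unique (@measurable_past _ _ _ i) (gP y) (g0P y).
Qed.

End BetaBound.

(** * Approximation by stationary chains *)

Section L1Metric.
Variables (R : realType) (T : finType).
Implicit Types p q : pmf R T.

Definition l1dist p q : R := \sum_x `|p x - q x|.

Lemma l1dist_metric : is_metric l1dist.
Proof.
split=> [p q|p q|p q|p q r].
- exact: sumr_ge0.
- split=> [h|->]; last by rewrite /l1dist big1// => x _; rewrite subrr normr0.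
  apply/val_inj/ffunP => x; apply/eqP; rewrite -subr_eq0; apply/eqP.
  by apply: (@l1norm_eq0 _ _ (fun x => p x - q x)); rewrite -h lexx.
- by apply: eq_bigr => x _; rewrite distrC.
- exact: (l1norm_triangle p q r).
Qed.

Lemma pmf_integral_dist (f : T -> R) p q :
  `|pmf_integral p f - pmf_integral q f| <= (\sum_x `|f x|) * l1dist p q.
Proof.
rewrite /pmf_integral -sumrB mulr_suml; apply: le_trans (ler_norm_sum _ _ _) _.
apply: ler_sum => x _; rewrite -mulrBr normrM ler_wpM2l// /l1dist.
by rewrite (bigD1 x)//= lerDl sumr_ge0.
Qed.

Lemma pmf_coord_near p x (e : R) : 0 < e ->
  nbhs p [set q : pmf R T | `|p x - q x| < e].
Proof.
move=> e0; pose f y : R := (y == x)%:R.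
have fE q : pmf_integral q f = q x.
  rewrite /pmf_integral (bigD1 x)//= /f eqxx mul1r big1 ?addr0// => y /negPf ->.
  by rewrite mul0r.
pose W : set (prod_topology (fun _ : T -> R => R)) :=
  [set g | ball (p x) e (g f)].
have nW : nbhs (pmf_integral p) W.
  have /cvg_sup/(_ f) : nbhs (pmf_integral p) --> pmf_integral p.
    exact: cvg_id.
  apply; exists W; split=> //; last by rewrite /W /= fE; exact: ballxx.
  by exists (ball (p x) e) => //; exact: ball_open.
have : nbhs p (@pmf_integral R T @^-1` W).
  exact: (@initial_continuous _ _ (@pmf_integral R T) p W nW).
by apply: filterS => q; rewrite /W /= fE.
Qed.

(** A weak neighbourhood controls each of the finitely many coordinates, hence the l^1 distance;
    conversely every integral is l^1-Lipschitz, so the filter of l^1 balls around p converges weakly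
    to p. *)
Lemma l1dist_metrizes : metrizes l1dist.
Proof.
split=> [|p U]; first exact: l1dist_metric.
split=> [|[e e0 eU]]; last first.
  have d0 : 0 < e / #|T|.+1%:R by rewrite divr_gt0.
  have : nbhs p [set q : pmf R T | forall x, `|p x - q x| < e / #|T|.+1%:R].
    apply: (@filter_forall (pmf R T) T
      (fun x q => `|p x - q x| < e / #|T|.+1%:R) (nbhs p)) => x.
    exact: pmf_coord_near.
  apply: filterS => q h; apply: eU; rewrite /= /l1dist.
  apply: (@le_lt_trans _ _ (\sum_(x : T) (e / #|T|.+1%:R))).
    by apply: ler_sum => x _; exact: ltW.
  rewrite sumr_const -[ltLHS]mulr_natr -mulrA -[ltRHS]mulr1 ltr_pM2l//.
  by rewrite mulrC ltr_pdivrMr ?ltr0n// mul1r ltr_nat cardE.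
pose F := filter_from [set e : R | 0 < e] (fun e => [set q | l1dist p q < e]).
have FF : Filter F.
  apply: filter_from_filter; first by exists 1 => /=.
  move=> d e d0 e0; exists (Num.min d e); first by rewrite /= lt_min d0.
  by move=> q /=; rewrite lt_min => /andP[].
suff : F --> p by move=> /[apply].
have cF : pmf_integral x @[x --> F] --> pmf_integral p.
  apply/cvg_sup => f V [B [[W oW <-] Wp]] /filterS; apply.
  have [e e0 eW] : exists2 e : R, 0 < e & ball (pmf_integral p f) e `<=` W.
    by apply/nbhs_ballP; apply: open_nbhs_nbhs; split.
  pose s := \sum_x `|f x| + 1.
  have s0 : 0 < s by rewrite ltr_wpDl// sumr_ge0.
  exists (e / s); first by rewrite /= divr_gt0.
  move=> q /= h; apply: eW; rewrite /ball /=.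
  apply: le_lt_trans (pmf_integral_dist _ _ _) _.
  rewrite ltr_pdivlMr// in h; apply: le_lt_trans h.
  by rewrite mulrC ler_wpM2l ?lerDl// sumr_ge0.
move=> V [B [[W oW <-] Wp]] /filterS; apply; apply: cF.
exact: open_nbhs_nbhs.
Qed.

Lemma tv_dist_le_l1dist p q : tv_dist p q <= l1dist p q.
Proof.
apply: bigmax_le => [|A _]; first exact: sumr_ge0.
rewrite /prob_of -sumrB; apply: le_trans (ler_norm_sum _ _ _) _.
rewrite /l1dist (bigID (mem A) predT)/= lerDl; exact: sumr_ge0.
Qed.

End L1Metric.

Lemma powR_small (R : realType) (p C e : R) : 0 < p -> 0 < C -> 0 < e ->
  exists2 d : R, 0 < d & forall t, 0 <= t -> t < d -> C * t `^ p < e.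
Proof.
move=> p0 C0 e0; have eC : 0 < e / C by rewrite divr_gt0.
exists ((e / C) `^ p^-1); first exact: powR_gt0.
move=> t t0 td; rewrite mulrC -ltr_pdivlMr//.
rewrite [ltRHS](_ : _ = ((e / C) `^ p^-1) `^ p).
  by apply: gt0_ltr_powR; rewrite ?nnegrE ?powR_ge0.
by rewrite -powRrM mulVf ?gt_eqF// powRr1// ltW.
Qed.

Section Approximation.
Variables (R : realType) (E : finType) (Q : R -> E -> E -> R).
Variables (kappa : R) (c : E).
Hypothesis hQ : forall u : R, u \in `[0, 1] -> is_transition (Q u).
Hypothesis hirr : forall u : R, u \in `[0, 1] -> irreducible (Q u).
Hypothesis haper : forall u : R, u \in `[0, 1] -> aperiodic (Q u).
Hypothesis hkappa : 0 < kappa < 1.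
Hypothesis hholder : forall x y, holder_on_unit kappa (fun u => Q u x y).

Lemma stationary_markov_product (V : process R E) (K : E -> E -> R) :
  stationary_markov_chain V K ->
  markov_product V (fun=> K) /\ push (marginal V 1) K = marginal V 1.
Proof.
move=> [hV hs].
have hm : markov_product V (fun=> K).
  move=> k m x y.
  exact: (@markov_product_chain _ _ _ _ _ (fun=> K) k m x y hV).
split=> //; rewrite [RHS](marginal_push hm) subrr; congr (push _ K).
apply/funext => x.
have := congr1 (fun p : pmf R (1.-tuple E) => p [tuple x]) (hs 1 0 1%N).
by rewrite !(law_path hm) /= !mulr1.
Qed.

(** The first state of the window costs the distance of marginals, and each later transition costs
    the Hölder error at its own time; together these form the sum over s. *)
Lemma law_distance : exists2 C : R, 0 < C &
  forall (n : nat) (u : R) (W V : process R E) (k : int) (j : nat),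
    (0 < n)%N -> u \in `[0, 1] -> (0 < j)%N ->
    markov_product W (array_kernel Q c n) -> stationary_markov_chain V (Q u) ->
    k + j%:Z - 1 <= n%:Z ->
    l1dist (law W k j) (law V 1 j) <=
      C * (\sum_(i < j) `|u - clip ((k + (i : nat)%:Z)%:~R / n%:R)| `^ kappa
           + 1 / n%:R `^ kappa).
Proof.
have [A [B [A0 B0 hAB]]] := marginal_distance hQ hkappa hholder hirr haper c.
have [G G0 hG] := holder_rows hholder.
exists (A + B + G); first by rewrite !addr_gt0.
move=> n u W V k [//|j] n0 hu _ hW /stationary_markov_product[hV invV] kj.
pose h (i : nat) := `|u - clip ((k + i%:Z)%:~R / n%:R)| `^ kappa.
have h0 i : 0 <= h i by exact: powR_ge0.
have path : l1dist (law W k j.+1) (law V 1 j.+1) <=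
    l1norm (marginal W k \- marginal V 1) + \sum_(i < j) (G * h i.+1).
  rewrite /l1dist.
  under eq_bigr do rewrite (law_path hW) (law_path hV).
  apply: (@path_weight_dist _ _ _ _ _ _ _ (fun i => G * h i.+1)).
  - exact: marginal_prob.
  - exact: marginal_prob.
  - by move=> i; exact: array_kernel_transition.
  - by move=> i; exact: hQ.
  move=> i x ij.
  have kn : k + 1 + i%:Z <= n%:Z by clear -kj ij; lia.
  rewrite /array_kernel kn; under eq_bigr do rewrite distrC.
  rewrite /h (_ : k + i.+1%:Z = k + 1 + i%:Z); last by clear; lia.
  exact: hG (mem_unit_clip_ratio R n0 kn).
have kn : k <= n%:Z by clear -kj; lia.
have start := hAB n u (marginal W) (marginal V 1) k n0 hu (marginal_prob W)
  (marginal_push hW) (marginal_prob V 1) invV kn.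
have kk : `|u - clip (k%:~R / n%:R)| `^ kappa = h 0%N by rewrite /h addr0.
rewrite kk in start.
set z := 1 / _; have zE : B / n%:R `^ kappa = B * z by rewrite /z div1r.
have z0 : 0 <= z by rewrite /z div1r invr_ge0 powR_ge0.
have S0 : 0 <= \sum_(i < j) h i.+1 by exact: sumr_ge0.
rewrite -/h big_ord_recl /= -/(h 0%N).
rewrite (eq_bigr (fun i : 'I_j => h i.+1)); last by [].
apply: (le_trans path); rewrite -mulr_sumr.
apply: le_trans (lerD start (lexx _)) _.
rewrite zE; set S := \sum_(i < j) h i.+1 in S0 *.
have := h0 0%N; move: (h 0%N) => t t0.
rewrite -subr_ge0.
have -> : (A + B + G) * (t + S + z) - (A * t + B * z + G * S) =
  A * S + A * z + B * t + B * S + G * t + G * z by ring.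
by rewrite !addr_ge0// mulr_ge0// ltW.
Qed.

(** The law is even kappa-Hölder in l^1: the initial law contributes [invariant_holder], each later
    transition one Hölder error. *)
Lemma stationary_law_continuous (Y : R -> process R E) (j : nat) : (0 < j)%N ->
  (forall u, u \in `[0, 1] -> stationary_markov_chain (Y u) (Q u)) ->
  {within `[0, 1], continuous (fun u : R => law (Y u) 1 j)}.
Proof.
case: j => // j _ hY.
have [A A0 hA] := invariant_holder hQ hkappa hholder hirr haper.
have [G G0 hG] := holder_rows hholder.
have /andP[k0 _] := hkappa.
pose C := A + j%:R * G.
have C0 : 0 < C by rewrite ltr_wpDr// mulr_ge0// ltW.
have dist u v : u \in `[0, 1] -> v \in `[0, 1] ->
    l1dist (law (Y u) 1 j.+1) (law (Y v) 1 j.+1) <= C * `|u - v| `^ kappa.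
  move=> hu hv.
  have [mu iu] := stationary_markov_product (hY u hu).
  have [mv iv] := stationary_markov_product (hY v hv).
  rewrite /l1dist.
  under eq_bigr do rewrite (law_path mu) (law_path mv).
  apply: le_trans (@path_weight_dist _ _ _ _ _ _ _
    (fun=> G * `|u - v| `^ kappa) _ _ _ _ _) _.
  - exact: marginal_prob.
  - exact: marginal_prob.
  - by move=> i; exact: hQ.
  - by move=> i; exact: hQ.
  - by move=> i x _; exact: hG.
  rewrite sumr_const card_ord -mulr_natl mulrA /C mulrDl lerD2r.
  by apply: hA => //; exact: marginal_prob.
apply/subspace_continuousP => u hu U.
move/((l1dist_metrizes R _).2 (law (Y u) 1 j.+1) U).1 => [e e0 eU].
have [d d0 hd] := powR_small k0 C0 e0.
rewrite /nbhs /= /within /=; apply/nbhs_ballP; exists d => // v uv hv.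
by apply: eU; apply: le_lt_trans (dist u v hu hv) _; exact: hd.
Qed.

Lemma array_locally_stationary (X : nat -> process R E) (Y : R -> process R E) :
  (forall n, (0 < n)%N -> markov_product (X n) (array_kernel Q c n)) ->
  (forall u, u \in `[0, 1] -> stationary_markov_chain (Y u) (Q u)) ->
  locally_stationary X (fun u j => law (Y u) 1 j).
Proof.
move=> hX hY j j0; exists (@l1dist R _); split.
- exact: l1dist_metrizes.
- exact: stationary_law_continuous.
have [C C0 hC] := law_distance.
have /andP[k0 _] := hkappa.
(* For u = clip (k/n), all times of the window have parameters within j/n of u, so each of the j
   summands is at most (j/n)^kappa, uniformly in k. *)
pose D := C * (j%:R * j%:R `^ kappa + 1).
have D0 : 0 < D by rewrite mulr_gt0// ltr_wpDl// mulr_ge0 ?powR_ge0.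
have bound (n : nat) (k : int) : (0 < n)%N -> k <= n%:Z - j%:Z + 1 ->
    l1dist (law (X n) k j) (law (Y (clip (k%:~R / n%:R))) 1 j) <=
    D * (n%:R^-1) `^ kappa.
  move=> n0 kj.
  have kn : k <= n%:Z by clear -kj j0; lia.
  have hu := mem_unit_clip_ratio R n0 kn.
  apply: le_trans (hC n _ _ _ k j n0 hu j0 (hX n n0) (hY _ hu) _) _.
    by clear -kj; lia.
  rewrite /D -mulrA; apply: ler_wpM2l; first exact: ltW.
  rewrite mulrDl !mul1r powRV ?ltr0n// lerD2r.
  rewrite -powRV ?ltr0n// -mulrA -powRM ?invr_ge0// -[X in X%:R * _]card_ord.
  rewrite mulr_natl -sumr_const; apply: ler_sum => i _.
  apply: ge0_ler_powR; rewrite ?nnegrE ?mulr_ge0 ?invr_ge0// ?(ltW k0)//.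
  apply: le_trans (clip_dist _ _) _.
  rewrite -mulrBl -intrB opprD addNKr.
  rewrite rmorphN normrM normrN normfV !normr_nat ler_wpM2r ?invr_ge0//.
  by rewrite ler_nat ltnW.
apply: (@squeeze_cvge _ _ _ _ (cst 0%E) _
  (fun n => (D * (n%:R^-1) `^ kappa)%:E)).
- exists 1%N => // n /= n0; apply/andP; split.
    (* The index set contains k = n - j + 1, so the supremum is not the default -oo. *)
    apply: le_trans (ereal_sup_ubound (x := (l1dist _ _)%:E) _); last first.
      by exists (n%:Z - j%:Z + 1) => /=.
    by rewrite lee_fin sumr_ge0.
  by apply: ge_ereal_sup => _ [k /= kj <-]; rewrite lee_fin bound.
- exact: cvg_cst.
apply: cvg_EFin; first exact: nearW.
apply/cvgrPdist_lt => e e0; have [d d0 hd] := powR_small k0 D0 e0.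
near=> n; rewrite sub0r normrN ger0_norm; last first.
  by apply: mulr_ge0; [exact: ltW|exact: powR_ge0].
apply: hd; first by rewrite invr_ge0.
have n0 : (0 < n)%N by near: n; exact: nbhs_infty_gt.
rewrite invf_plt ?posrE ?ltr0n//.
apply: lt_le_trans (archi_boundP _) _; first by rewrite invr_ge0 ltW.
by rewrite ler_nat; near: n; exact: nbhs_infty_ge.
Unshelve. all: by end_near. Qed.

End Approximation.

Unset Implicit Arguments.

Theorem corollary1 (R : realType) (E : finType) (Q : R -> E -> E -> R) (kappa : R)
    (X : nat -> process R E) (c : E)
    (hQ : forall u, u \in `[0, 1] -> is_transition (Q u))
    (hirr : forall u, u \in `[0, 1] -> irreducible (Q u))
    (haper : forall u, u \in `[0, 1] -> aperiodic (Q u))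
    (hkappa : 0 < kappa < 1)
    (hholder : forall x y, holder_on_unit kappa (fun u => Q u x y))
    (hX : forall n : nat, (0 < n)%N ->
       markov_chain (X n) [set k : int | k <= n%:Z]
         (fun k : int => Q (clip (k%:~R / n%:R))))
    (hXc : forall (n : nat) (k : int) (w : process_space (X n)), (0 < n)%N ->
       n%:Z < k -> X n k w = c) :
  [/\ (* (i), invariant probabilities *)
      forall u, u \in `[0, 1] -> exists! p : pmf R E, invariant_prob (Q u) p,
      (* (i), with pi_{u,j} the law of (Y u 1, ..., Y u j) *)
      forall Y : R -> process R E,
        (forall u, u \in `[0, 1] -> stationary_markov_chain (Y u) (Q u)) ->
        locally_stationary X (fun u j => law (Y u) 1 j) /\
        exists2 C : R, 0 < C &
          forall (u : R) (n j : nat) (k : int),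
            u \in `[0, 1] -> (0 < n)%N -> (0 < j)%N -> k + j%:Z - 1 <= n%:Z ->
            tv_dist (law (X n) k j) (law (Y u) 1 j)
            <= C * (\sum_(i < j) `|u - (k + (i : nat)%:Z)%:~R / n%:R| `^ kappa
                    + 1 / n%:R `^ kappa) &
      (* (ii) *)
      exists (C' rho : R) (m : nat),
        [/\ 0 < C', 0 < rho < 1, (1 <= m)%N &
            forall n j : nat, (0 < n)%N -> (0 < j)%N ->
              (beta (X n) j <= (C' * rho ^+ (j %/ m))%:E)%E] ].
Proof.
have hXm n : (0 < n)%N -> markov_product (X n) (array_kernel Q c n).
  move=> n0 k m x y; have [kn|nk] := leP k n%:Z.
    apply: (@markov_product_chain _ _ _ _ _ (array_kernel Q c n) k m x y
      (hX n n0)).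
      exact: kn.
    by rewrite /array_kernel kn.
  (* After time n the constant value [c] makes the event sure or empty. *)
  rewrite /array_kernel leNgt nk /=.
  have [->|yc] := eqVneq y c.
    rewrite mulr1 (_ : X n k @^-1` [set c] = setT) ?setTI//.
    by apply/seteqP; split=> // w _ /=; exact: hXc.
  rewrite mulr0 (_ : X n k @^-1` [set y] = set0) ?set0I ?/pr ?measure0//.
  by apply/seteqP; split=> // w /=; rewrite hXc// => cy; rewrite cy eqxx in yc.
split.
- by move=> u; exact: (unique_invariant hQ hkappa hholder hirr haper c).
- move=> Y hY; split.
    exact: (array_locally_stationary hQ hirr haper hkappa hholder hXm hY).
  have [C C0 hC] := law_distance c hQ hirr haper hkappa hholder.
  have /andP[k0 _] := hkappa.
  exists C => // u n j k hu n0 j0 kj; apply: le_trans (tv_dist_le_l1dist _ _) _.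
  apply: le_trans (hC n u _ _ k j n0 hu j0 (hXm n n0) (hY u hu) kj) _.
  rewrite ler_wpM2l ?(ltW C0)// lerD2r; apply: ler_sum => i _.
  apply: ge0_ler_powR; rewrite ?nnegrE// ?(ltW k0)//.
  (* As [clip] is 1-Lipschitz and fixes u, clipping s/n cannot move it away from u. *)
  by rewrite -{1}(clip_id hu); exact: clip_dist.
- have [m [r [m0 /andP[r0 r1] hc]]] :=
    array_block_contraction hQ hkappa hholder hirr haper c.
  (* C' = 1 because the bound 2 on the distance of two probability vectors cancels the factor 1/2 in
     [beta]. *)
  exists 1, r, m; split=> //; first by rewrite r0.
  move=> n j n0 _; rewrite mul1r.
  have tr k : is_transition (array_kernel Q c n k).
    exact: array_kernel_transition.
  apply: (beta_le (hXm n n0)) => // [|i]; first by rewrite exprn_ge0// ltW.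
  apply: contracting_iter => // [|l]; first exact: ltW.
  apply: eq_contracting (hc n (i + 1 + l%:Z) n0) => a _.
  by congr (array_kernel Q c n); clear; lia.
Qed.
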